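(* (i) For $n\ge 18$ we have $F(n,3)=F'(n,2)$. (ii) We have $\lim_{n\rightarrow\infty}G(n,3)=\lim_{n\rightarrow\infty}G'(n,2)=1+\sqrt{2}$.
   Context: $B_n$ is the Boolean lattice of all subsets of $[n]=\{1,\dots,n\}$ ordered by inclusion. The Lubell-mass of $\mathcal{F}\subseteq B_n$ is $\lambda_n(\mathcal{F})=\sum_{F\in\mathcal{F}}\binom{n}{|F|}^{-1}$. Given a (partial) coloring of $B_n$, a strong rainbow copy of $A_k$ is a set of $k$ pairwise incomparable colored elements of $B_n$ (an antichain of size $k$) having pairwise distinct colors. $F(n,k)$ is the smallest integer $m$ such that any $k$-coloring $\phi:B_n\rightarrow [k]$ in which every color class $\phi^{-1}(i)$, $i\in[k]$, has size at least $m$ admits a strong rainbow copy of $A_k$. $G(n,k)$ is the infimum of all reals $\gamma$ such that any $k$-coloring $\phi:B_n\rightarrow [k]$ in which every color class has Lubell-mass at least $\gamma$ admits a strong rainbow copy of $A_k$. $F'(n,k)$ and $G'(n,k)$ are defined in the same way as $F(n,k)$ and $G(n,k)$, respectively, with colorings replaced by partial colorings, i.e. maps $\phi$ from an arbitrary subset of $B_n$ to $[k]$. *)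

(* Defs.v *)
From HB Require Import structures.
From mathcomp Require Import all_boot all_order all_algebra.
From mathcomp Require Import all_classical all_reals all_analysis.

Set Implicit Arguments.
Unset Strict Implicit.
Unset Printing Implicit Defensive.

Import Order.TTheory GRing.Theory Num.Theory.

(* The Boolean lattice B_n is [{set 'I_n}], ordered by [\subset]. *)

Definition coloring (n k : nat) := {ffun {set 'I_n} -> 'I_k}.

(* [None] marks the sets outside the domain of the partial coloring. *)
Definition pcoloring (n k : nat) := {ffun {set 'I_n} -> option 'I_k}.

Definition partial_of n k (phi : coloring n k) : pcoloring n k :=
  [ffun S => Some (phi S)].

Definition color_class n k (phi : pcoloring n k) (i : 'I_k) : {set {set 'I_n}} :=
  [set S | phi S == Some i]%SET.

Definition antichain n (A : {set {set 'I_n}}) : bool :=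
  [forall S in A, forall T in A,
     (S != T) ==> ~~ (S \subset T) && ~~ (T \subset S)].

Definition strong_rainbow n k (phi : pcoloring n k) : bool :=
  [exists A : {set {set 'I_n}},
    [&& #|A| == k, antichain A,
        [forall S in A, phi S != None] & dinjectiveb phi (mem A)]].

Definition lubell (R : realType) n (A : {set {set 'I_n}}) : R :=
  (\sum_(S in A) ('C(n, #|S|)%:R)^-1)%R.

Definition Fpcol_prop (n k m : nat) : bool :=
  [forall phi : pcoloring n k,
     [forall i : 'I_k, m <= #|color_class phi i|] ==> strong_rainbow phi].

Definition Fcol_prop (n k m : nat) : bool :=
  [forall phi : coloring n k,
     [forall i : 'I_k, m <= #|color_class (partial_of phi) i|]
       ==> strong_rainbow (partial_of phi)].

Lemma Fpcol_ex n k : exists m, Fpcol_prop n k m.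
Proof.
exists #|{set 'I_n}|.+1; apply/forallP => phi; apply/implyP => /forallP big.
case: k phi big => [|k] phi big; last first.
  by have := big ord0; rewrite ltnNge max_card.
apply/existsP; exists finset.set0; apply/and4P; split.
- by rewrite cards0.
- by apply/forall_inP => S; rewrite inE.
- by apply/forall_inP => S; rewrite inE.
- by apply/dinjectiveP => S T; rewrite inE.
Qed.

Lemma Fcol_ex n k : exists m, Fcol_prop n k m.
Proof.
have [m /forallP mP] := Fpcol_ex n k.
by exists m; apply/forallP => phi; apply: mP.
Qed.

(* For k >= 2 a constant coloring has no strong rainbow copy of A_k, so m = 0
   never qualifies and the least integer is the least natural number. *)
Definition Fcol (n k : nat) : nat := ex_minn (Fcol_ex n k).
Definition Fpcol (n k : nat) : nat := ex_minn (Fpcol_ex n k).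

(* For k >= 2 these sets of reals are nonempty (take gamma > n + 1) and bounded
   below by 0 (constant coloring), so [inf] is a genuine infimum. *)
Definition Gcol (R : realType) (n k : nat) : R :=
  inf [set gamma : R | forall phi : coloring n k,
         (forall i : 'I_k, gamma <= lubell R (color_class (partial_of phi) i))%R ->
         strong_rainbow (partial_of phi)]%classic.

Definition Gpcol (R : realType) (n k : nat) : R :=
  inf [set gamma : R | forall phi : pcoloring n k,
         (forall i : 'I_k, gamma <= lubell R (color_class phi i))%R ->
         strong_rainbow phi]%classic.

(* Main.v *)
(** Fix one level [k] of the Boolean lattice.  A colouring with three colours and
    no rainbow antichain misses a colour [l] on that level, as the level is an
    antichain; call [i], [j] the other two.  A set of colour [l] cannot be
    incomparable both to a [k]-set of colour [i] and to one of colour [j], so it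
    is comparable to the whole colour-[i] part of the level or to the whole
    colour-[j] part.  Any two sets have a common incomparable [k]-set unless they
    are trivial or form a pair [{u}], [~: {u}] (an "atom pair").  Hence either
    class [l] has at most four elements, or all its members choose the same
    colour, say [i], and then the classes [i] and [l] are cross-comparable up to
    atom pairs: this is the two-coloured problem.

    For a cross-comparable pair [A], [B] of families, ignoring [set0] and [setT],
    the union of the members of one family below a fixed member of the other
    family is comparable to everything ("a cut").  Without a cut of size between
    [n/8] and [7n/8] one of the two Lubell masses is at most [2/7]; a cut of
    central size [y] shows that up to [O(1/n)] one family lives below it and the
    other above it, with masses at most [y / (n - y)] and [(n - y) / y].  As
    [set0] and [setT] contribute 2 in total, the best balance is
    [x + 2 = 1 / x], i.e. [1 / x = 1 + sqrt 2]; it is attained by the subsets of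
    [Y] together with [setT] against the proper supersets of [Y]. *)

Require Import Defs.
From HB Require Import structures.
From mathcomp Require Import all_boot all_order all_algebra.
From mathcomp Require Import zify ring lra.
From mathcomp Require Import all_classical all_reals all_analysis.

Set Implicit Arguments.
Unset Strict Implicit.
Unset Printing Implicit Defensive.

Import Order.TTheory GRing.Theory Num.Theory.
Import numFieldNormedType.Exports.
Import mathcomp.boot.fintype mathcomp.boot.finset.

(** * Comparability, atom pairs and common incomparable sets *)

Definition cmp n (S T : {set 'I_n}) : bool := (S \subset T) || (T \subset S).

(** A set incomparable to [[set u]] misses [u], hence lies inside [~: [set u]]: no set is
    incomparable to both members of such a pair. *)
Definition atom_pair n (S T : {set 'I_n}) : bool :=
  (S == ~: T) && ((#|S| == 1) || (#|T| == 1)).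

Definition near_cross n (A B : {set {set 'I_n}}) : Prop :=
  forall S T, S \in A -> T \in B -> cmp S T || atom_pair S T.

Lemma cmpC n (S T : {set 'I_n}) : cmp S T = cmp T S.
Proof. exact: orbC. Qed.

Lemma atom_pairC n (S T : {set 'I_n}) : atom_pair S T = atom_pair T S.
Proof.
rewrite /atom_pair orbC; congr (_ && _).
by apply/eqP/eqP => ->; rewrite setCK.
Qed.

Lemma near_crossC n (A B : {set {set 'I_n}}) : near_cross A B -> near_cross B A.
Proof. by move=> AB S T SB TA; rewrite cmpC atom_pairC AB. Qed.

Lemma exists_set_between n (P Q : {set 'I_n}) k :
  P \subset Q -> #|P| <= k <= #|Q| ->
  exists U : {set 'I_n}, [/\ P \subset U, U \subset Q & #|U| = k].
Proof.
move=> PQ; elim: k => [|k IHk] /andP[Pk kQ].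
  by exists P; rewrite PQ subxx; split=> //; apply/eqP; rewrite -leqn0.
move: Pk; rewrite leq_eqVlt => /orP[/eqP Pk|Pk]; first by exists P; rewrite subxx PQ.
have [|U [PU UQ Uk]] := IHk; first by rewrite -ltnS Pk ltnW.
have /properP[_ [x xQ xU]] : U \proper Q.
  by rewrite properEcard UQ Uk.
exists (x |: U); split; first exact: subset_trans PU (subsetUr _ _).
  by rewrite subUset sub1set xQ.
by rewrite cardsU1 xU Uk.
Qed.

Lemma eq_level_cmp n (S T : {set 'I_n}) : #|S| = #|T| -> cmp S T -> S = T.
Proof.
move=> ST /orP[sub|sub]; last apply/esym; apply/eqP;
by rewrite eqEcard sub ST /=.
Qed.

(** Each of the two sets makes one demand on [U]: a set of size at most [k] has an element to be
    left out, a larger one has a non-element to be put in. Two demands of the same kind are met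
    thanks to [1 < k] or [k.+1 < n]; two of opposite kinds clash only for an atom pair. *)
Lemma common_incomparable_set n (S T : {set 'I_n}) k :
  1 < k -> k.+1 < n -> S != set0 -> S != setT -> T != set0 -> T != setT ->
  ~~ atom_pair S T ->
  exists U : {set 'I_n}, [/\ #|U| = k, ~~ cmp U S & ~~ cmp U T].
Proof.
move=> k1 kn.
(* The witness separating [U] from [X]: an element of [X] outside [U] if [X]
   is small, an element of [U] outside [X] if it is large. *)
have small (X U : {set 'I_n}) x :
    #|X| <= k -> #|U| = k -> x \in X -> x \notin U -> ~~ cmp U X.
  move=> Xk Uk xX xU; apply/negP => /orP[UX|/subsetP/(_ x xX)]; last exact/negP.
  have /eqP XU : U == X by rewrite eqEcard UX Uk.
  by rewrite XU xX in xU.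
have large (X U : {set 'I_n}) x :
    k <= #|X| -> #|U| = k -> x \notin X -> x \in U -> ~~ cmp U X.
  move=> Xk Uk xX xU; apply/negP => /orP[/subsetP/(_ x xU)|XU]; first exact/negP.
  have /eqP XU' : X == U by rewrite eqEcard XU Uk.
  by rewrite XU' xU in xX.
have nonfull (X : {set 'I_n}) : X != setT -> exists x, x \notin X.
  by rewrite -properT => /properP[_ [x _ ?]]; exists x.
wlog le_ST : S T / #|S| <= #|T|.
  move=> wl S0 ST T0 TT; have [/wl|/ltnW /wl] := leqP #|S| #|T|; first exact.
  rewrite atom_pairC => H /H[] // U [Uk US UT]; by exists U.
move=> S0 ST T0 TT nST.
have [Sk|/ltnW kS] := leqP #|S| k; last first.
  have [s sS] := nonfull _ ST; have [t tT] := nonfull _ TT.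
  have [||U [PU _ Uk]] := @exists_set_between n [set s; t] setT k; first exact: subsetT.
    by rewrite cards2 cardsT card_ord; case: (s != t) => /=; lia.
  exists U; split=> //.
    by apply: (large _ _ s) => //; rewrite (subsetP PU) // !inE eqxx.
  by apply: (large _ _ t) => //; rewrite ?(leq_trans kS) // (subsetP PU) // !inE eqxx orbT.
have [s sS] := set0Pn _ S0.
have [Tk|/ltnW kT] := leqP #|T| k.
  have [t tT] := set0Pn _ T0.
  have [||U [_ UP Uk]] := @exists_set_between n set0 (~: [set s; t]) k; first exact: sub0set.
    rewrite cards0 cardsCs setCK card_ord cards2.
    by case: (s != t) => /=; lia.
  exists U; split=> //.
    apply: (small _ _ s) => //; apply: contraL sS => /(subsetP UP).
    by rewrite !inE eqxx.
  apply: (small _ _ t) => //; apply: contraL tT => /(subsetP UP).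
  by rewrite !inE eqxx orbT.
(* Now [S] is small and [T] large. If every element of [S] equals every non-element of [T], then [S]
   is a singleton and [T] its complement. *)
have [[s' t] /= /and3P[s'S tT neq]] :
    exists p : 'I_n * 'I_n, [&& p.1 \in S, p.2 \notin T & p.1 != p.2].
  apply/existsP; apply: contraNT nST => /existsPn H.
  have [t tT] := nonfull _ TT.
  have Eq x y : x \in S -> y \notin T -> x = y.
    by move=> xS yT; have := H (x, y); rewrite /= xS yT negbK => /eqP.
  have ES : S = [set s].
    apply/setP => x; rewrite inE; apply/idP/eqP => [xS|-> //].
    by rewrite (Eq x t) // (Eq s t).
  have ET : T = ~: [set s].
    apply/setP => x; rewrite !inE; apply/idP/idP => [xT|].
      by apply: contraTneq xT => ->; rewrite (Eq s t).
    by apply: contraR => xT; rewrite (Eq s x).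
  by rewrite /atom_pair ES ET setCK eqxx cards1.
have [||U [PU UQ Uk]] := @exists_set_between n [set t] (~: [set s']) k.
- by rewrite sub1set !inE eq_sym.
- rewrite cards1 cardsCs setCK card_ord cards1; lia.
exists U; split=> //.
  by apply: (small _ _ s') => //; apply: contraL s'S => /(subsetP UQ); rewrite !inE eqxx.
by apply: (large _ _ t) => //; rewrite (subsetP PU) // inE.
Qed.

(** * Rainbow antichains and the structure of three-colourings *)

Lemma strong_rainbowP n k (phi : pcoloring n k) :
  reflect (exists2 f : 'I_k -> {set 'I_n}, forall i, phi (f i) = Some i &
             forall i j, i != j -> ~~ cmp (f i) (f j))
          (strong_rainbow phi).
Proof.
apply: (iffP existsP) => [[A /and4P[/eqP Ak /forall_inP anti /forall_inP col]]|[f fK inc]].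
  move=> /dinjectiveP inj.
  (* The antichain carries [k] distinct colours out of [k], so every colour occurs in it. *)
  have im : phi @: A = [set Some i | i : 'I_k].
    apply/eqP; rewrite eqEcard; apply/andP; split.
      apply/fintype.subsetP => _ /imsetP[S SA ->]; have := col S SA.
      by case: (phi S) => // i _; apply: imset_f.
    rewrite card_imset; last by move=> i j [].
    by rewrite (card_in_imset inj) Ak card_ord.
  have ex i : exists S, (S \in A) && (phi S == Some i).
    have : Some i \in phi @: A by rewrite im imset_f.
    by case/imsetP => S SA ->; exists S; rewrite SA eqxx.
  exists (fun i => xchoose (ex i)) => [i|i j ij].
    by have /andP[_ /eqP] := xchooseP (ex i).
  have /andP[iA /eqP iE] := xchooseP (ex i).
  have /andP[jA /eqP jE] := xchooseP (ex j).
  have /forall_inP/(_ _ jA)/implyP := anti _ iA; rewrite negb_or; apply.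
  by apply: contraNneq ij => E; move: jE; rewrite -E iE => -[->].
have fI : injective f by move=> i j E; have := fK i; rewrite E fK => -[].
exists [set f i | i : 'I_k]; apply/and4P; split.
- by rewrite card_imset // card_ord.
- apply/forall_inP => _ /imsetP[i _ ->]; apply/forall_inP => _ /imsetP[j _ ->].
  apply/implyP; rewrite (inj_eq fI) => /inc.
  by rewrite negb_or.
- by apply/forall_inP => _ /imsetP[i _ ->]; rewrite fK.
- apply/dinjectiveP => _ _ /imsetP[i _ ->] /imsetP[j _ ->].
  by rewrite !fK => -[->].
Qed.

Lemma strong_rainbow3 n (phi : coloring n 3) (S T U : {set 'I_n}) :
  phi S != phi T -> phi S != phi U -> phi T != phi U ->
  ~~ cmp S T -> ~~ cmp S U -> ~~ cmp T U -> strong_rainbow (partial_of phi).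
Proof.
move=> nST nSU nTU iST iSU iTU; apply/strong_rainbowP.
have cover i : [|| i == phi S, i == phi T | i == phi U].
  move: nST nSU nTU; rewrite -!(inj_eq val_inj) /=.
  move: (phi S) (phi T) (phi U) i => [a ?] [b ?] [c ?] [d ?] /=; lia.
pose f i := if i == phi S then S else if i == phi T then T else U.
have fS : f (phi S) = S by rewrite /f eqxx.
have fT : f (phi T) = T by rewrite /f eq_sym (negPf nST) eqxx.
have fU : f (phi U) = U.
  by rewrite /f ![phi U == _]eq_sym (negPf nSU) (negPf nTU).
exists f => [i|i j]; first by rewrite ffunE; case/or3P: (cover i) => /eqP ->; rewrite ?fS ?fT ?fU.
case/or3P: (cover i) => /eqP ->; case/or3P: (cover j) => /eqP ->;
  by rewrite ?fS ?fT ?fU ?eqxx // cmpC.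
Qed.

Lemma three_coloring_structure n k (phi : coloring n 3) :
  1 < k -> k.+1 < n -> ~~ strong_rainbow (partial_of phi) ->
  (exists i j : 'I_3, i != j /\
     near_cross (color_class (partial_of phi) i) (color_class (partial_of phi) j)) \/
  (exists (l : 'I_3) (T : {set 'I_n}), (#|T| == 1) || (#|~: T| == 1) /\
     color_class (partial_of phi) l \subset [set set0; setT; T; ~: T]).
Proof.
move=> k1 kn nr.
have in_class i S : (S \in color_class (partial_of phi) i) = (phi S == i).
  by rewrite inE ffunE.
have rainbow S T U : phi S != phi T -> phi S != phi U -> phi T != phi U ->
    ~~ cmp S T -> ~~ cmp S U -> ~~ cmp T U -> False.
  by move=> *; move/negP: nr; apply; apply: (@strong_rainbow3 _ _ S T U).
(* One set of each colour on level [k] would form a rainbow antichain. *)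
have [l lk] : exists l, forall U : {set 'I_n}, #|U| = k -> phi U != l.
  pose missed l := [forall U : {set 'I_n}, (#|U| == k) ==> (phi U != l)].
  suff: [exists l, missed l].
    by move=> /existsP[l /forallP H]; exists l => U /eqP Uk; apply: (implyP (H U)).
  apply/existsPn => all_colors; move: nr; apply/negP; rewrite negbK; apply/strong_rainbowP.
  have ex i : exists U : {set 'I_n}, (#|U| == k) && (phi U == i).
    have /forallPn[U] := all_colors i.
    by rewrite negb_imply negbK => ?; exists U.
  exists (fun i => xchoose (ex i)) => [i|i j ij].
    by have /andP[_ /eqP E] := xchooseP (ex i); rewrite ffunE E.
  have /andP[/eqP ci /eqP pi] := xchooseP (ex i).
  have /andP[/eqP cj /eqP pj] := xchooseP (ex j).
  apply: contraNN ij => /eq_level_cmp E.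
  by rewrite -pi -pj E ?ci.
have [i [j [ij il jl cover]]] : exists i j : 'I_3,
    [/\ i != j, i != l, j != l & forall c, c != l -> c = i \/ c = j].
  exists (ordS l), (ord_pred l).
  case: l {lk} => [[|[|[|//]]] l3]; split=> // -[[|[|[|//]]] c3] // _;
    by [left; apply: val_inj | right; apply: val_inj].
pose P c T := forall U : {set 'I_n}, #|U| = k -> phi U = c -> cmp U T.
(* If both failed, sets [U] of colour [j] and [U'] of colour [i] on level [k] would be rainbow
   together with [T]. *)
have dich T : phi T = l -> P i T \/ P j T.
  move=> Tl.
  case: (pselect (P i T)) => [|nPi]; [by left|right] => U Uk Uj.
  apply: contrapT => /negP nUT; apply: nPi => U' U'k U'i.
  apply: contrapT => /negP nU'T.
  apply: (rainbow U U' T) => //; rewrite ?Uj ?U'i ?Tl // 1?eq_sym //.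
  apply: contraNN ij => /eq_level_cmp E; by rewrite -Uj -U'i E ?Uk ?U'k.
(* For a bad pair [S], [T] take a common incomparable [k]-set [U]. Colour [a] for [U] contradicts
   [P a T]; colour [b] makes [S], [T], [U] rainbow. *)
have main a b : a != b -> a != l -> b != l -> (forall c, c != l -> c = a \/ c = b) ->
    (forall T, phi T = l -> P a T) -> near_cross (color_class (partial_of phi) a)
                                     (color_class (partial_of phi) l).
  move=> ab al bl cov allP S T; rewrite !in_class => /eqP Sa /eqP Tl.
  apply/negPn/negP; rewrite negb_or => /andP[nST nat].
  have triv (X Y : {set 'I_n}) : ~~ cmp X Y -> X != set0 /\ X != setT.
    rewrite negb_or => /andP[XY YX]; split.
      by apply: contraNneq XY => ->; rewrite sub0set.
    by apply: contraNneq YX => ->; rewrite subsetT.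
  have [S0 S1] := triv _ _ nST; have [T0 T1] : T != set0 /\ T != setT by apply: (triv _ S); rewrite cmpC.
  have [U [Uk US UT]] := common_incomparable_set k1 kn S0 S1 T0 T1 nat.
  have [Ua|Ub] := cov _ (lk U Uk); first by move/negP: UT; apply; apply: allP Ua.
  by apply: (rainbow S T U); rewrite ?Sa ?Tl ?Ub // 1?cmpC // 1?eq_sym.
have [allPi|nPi] := pselect (forall T, phi T = l -> P i T).
  by left; exists i, l; split=> //; apply: (main _ j).
have [allPj|nPj] := pselect (forall T, phi T = l -> P j T).
  left; exists j, l; split=> //; apply: (main _ i) => //; first by rewrite eq_sym.
  by move=> c /cover[]; [right|left].
right.
have [T [Tl nPT]] : exists T, phi T = l /\ ~ P i T.
  by apply: contrapT => H; apply: nPi => T Tl; apply: contrapT => nP; apply: H; exists T.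
have [T' [Tl' nPT']] : exists T, phi T = l /\ ~ P j T.
  by apply: contrapT => H; apply: nPj => X Xl; apply: contrapT => nP; apply: H; exists X.
have PT : P j T by case: (dich T Tl).
have PT' : P i T' by case: (dich T' Tl').
have nontriv c X : ~ P c X -> X != set0 /\ X != setT.
  move=> nP; split; apply/eqP => XE; apply: nP => U _ _; rewrite XE /cmp ?sub0set ?subsetT //.
  by rewrite orbT.
have [T0 T1] := nontriv _ _ nPT; have [T'0 T'1] := nontriv _ _ nPT'.
(* A common incomparable [k]-set would have colour [i] or [j], against [P i X] or [P j Y]. Since [T]
   and [T'] make opposite choices, using them as partners leaves only [T] and [~: T] as nontrivial
   members of colour [l]. *)
have complement X Y : P i X -> P j Y -> X != set0 -> X != setT -> Y != set0 -> Y != setT ->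
    atom_pair X Y.
  move=> PX PY X0 X1 Y0 Y1; apply/negPn/negP => nat.
  have [U [Uk UX UY]] := common_incomparable_set k1 kn X0 X1 Y0 Y1 nat.
  have [Ui|Uj] := cover _ (lk U Uk); first by move/negP: UX; apply; apply: PX.
  by move/negP: UY; apply; apply: PY.
have /andP[/eqP T'E T1E] := complement _ _ PT' PT T'0 T'1 T0 T1.
exists l, T; split; first by rewrite -T'E orbC.
apply/fintype.subsetP => R; rewrite in_class => /eqP Rl; rewrite !inE.
have [//|R0] := eqVneq R set0; have [//|R1] := eqVneq R setT.
have [PR|PR] := dich R Rl; rewrite /=.
  by have /andP[/eqP -> _] := complement _ _ PR PT R0 R1 T0 T1; rewrite eqxx orbT.
have /andP[/eqP RE _] := complement _ _ PT' PR T'0 T'1 R0 R1.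
by rewrite -[R]setCK -RE T'E setCK eqxx.
Qed.

(** * Cardinalities: two-coloured against three-coloured *)

(** [V] collects all points [v] with [[set v]] in [A] and [~: [set v]] in [B]. Comparison with these
    sets shows that the remaining nontrivial members of [A] miss [V] and those of [B] contain it;
    [Y] is the union of the former. *)
Lemma near_cross_atom_structure n (A B : {set {set 'I_n}}) (u : 'I_n) :
  [disjoint A & B] -> near_cross A B -> [set u] \in A -> ~: [set u] \in B ->
  exists Y V : {set 'I_n}, [/\ u \in V, [disjoint Y & V],
    A \subset setT |: (powerset Y :|: [set [set v] | v in V]) &
    B \subset set0 |: ([set Z : {set 'I_n} | Y :|: V \subset Z]
                         :|: [set ~: [set v] | v in V])].
Proof.
move=> dAB AB uA uB.
have notAB S : S \in A -> S \in B -> False.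
  by move=> SA SB; move: (disjointFr dAB SA); rewrite SB.
pose V := [set v | ([set v] \in A) && (~: [set v] \in B)].
pose sV := [set [set v] | v in V]; pose cV := [set ~: [set v] | v in V].
have uV : u \in V by rewrite inE uA uB.
have up v Z : v \in V -> Z \in B -> Z != set0 -> Z != ~: [set v] -> v \in Z.
  rewrite inE => /andP[vA _] ZB Z0 Zv.
  have /orP[/orP[|]|/andP[/eqP E _]] := AB _ _ vA ZB; first by rewrite sub1set.
    rewrite subset1 (negPf Z0) orbF => /eqP E.
    by case: (notAB _ vA); rewrite -E.
  by rewrite E setCK eqxx in Zv.
have down v S : v \in V -> S \in A -> S != setT -> S != [set v] -> v \notin S.
  rewrite inE => /andP[_ vB] SA ST Sv.
  have /orP[/orP[/fintype.subsetP sub|]|/andP[/eqP E _]] := AB _ _ SA vB.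
  - by apply/negP => /sub; rewrite !inE eqxx.
  - rewrite subCset subset1 => /orP[] /eqP /(congr1 (@setC _)); rewrite setCK.
      by move=> E; case: (notAB _ SA); rewrite E.
    by rewrite setC0 => E; rewrite E eqxx in ST.
  - by rewrite E setCK eqxx in Sv.
pose rest := [set S in A | (S != setT) && (S \notin sV)].
have nsV v S : v \in V -> S \notin sV -> S != [set v].
  by move=> vV; apply: contraNneq => ->; apply: imset_f.
have ncV v Z : v \in V -> Z \notin cV -> Z != ~: [set v].
  by move=> vV; apply: contraNneq => ->; apply: (imset_f (fun v => ~: [set v])).
exists (\bigcup_(S in rest) S), V; split=> //.
- rewrite disjoint_sym disjoint_subset; apply/fintype.subsetP => v vV.
  rewrite inE; apply/bigcupP => -[S]; rewrite inE => /and3P[SA ST SV].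
  by apply/negP; apply: down => //; apply: nsV.
- apply/fintype.subsetP => S SA; rewrite !inE.
  have [//|ST] := eqVneq S setT; have [|SV] := boolP (S \in sV).
    by rewrite !orbT.
  by rewrite (bigcup_sup S) // inE SA ST.
- apply/fintype.subsetP => Z ZB; rewrite !inE.
  have [//|Z0] := eqVneq Z set0; have [|ZV] := boolP (Z \in cV).
    by rewrite !orbT.
  have VZ : V \subset Z by apply/fintype.subsetP => v vV; apply: up => //; apply: ncV.
  have uZ : u \in Z by apply: (fintype.subsetP VZ).
  rewrite subUset VZ andbT orbF /=; apply/bigcupsP => S; rewrite inE => /and3P[SA ST SV].
  have uS : u \notin S by apply: down => //; apply: nsV.
  (* As [u] is in [Z] but not in [S], comparability can only mean [S \subset Z]. An atom pair would
     put the point of [S] into [V], or make [Z] the set [[set u]], which is in [A]. *)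
  have /orP[/orP[//|ZS]|/andP[/eqP SZ /orP[] /cards1P[w E]]] := AB _ _ SA ZB.
  + by move: uS; rewrite (fintype.subsetP ZS).
  + have wV : w \in V by rewrite inE -E SA E -(setCK Z) -SZ E in ZB *; rewrite ZB.
    by move: (nsV _ _ wV SV); rewrite E eqxx.
  + move: uZ; rewrite E inE => /eqP uw; case: (notAB _ uA).
    by rewrite uw -E.
Qed.

Lemma near_cross_cmp n (A B : {set {set 'I_n}}) :
  near_cross A B -> (forall S T, S \in A -> T \in B -> cmp S T) \/
  (exists u, [set u] \in A /\ ~: [set u] \in B) \/
  (exists u, [set u] \in B /\ ~: [set u] \in A).
Proof.
move=> AB.
have [?|H] := pselect (forall S T, S \in A -> T \in B -> cmp S T); [by left|right].
have [S [T [SA TB /negPf nST]]] : exists S T, [/\ S \in A, T \in B & ~~ cmp S T].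
  apply: contrapT => H'; apply: H => S T SA TB; apply: contrapT => /negP nST.
  by apply: H'; exists S, T.
move: (AB _ _ SA TB); rewrite nST /= => /andP[/eqP SE /orP[] /cards1P[u E]].
  by left; exists u; rewrite -E SE setCK -SE.
by right; exists u; rewrite -E -SE.
Qed.

Lemma card_supersets (T : finType) (Y : {set T}) :
  #|[set Z : {set T} | Y \subset Z]| = 2 ^ #|~: Y|.
Proof.
rewrite -card_powerset -(card_imset _ (@setC_inj T)); apply: eq_card => Z.
rewrite inE; apply/imsetP/idP => [[X]|ZY].
  by rewrite inE => YX ->; rewrite setCS.
by exists (~: Z); rewrite ?setCK // inE -setCS setCK.
Qed.

(** With [h = n./2]: if [y < h] or [w < h], the corresponding power is at most half of [2 ^ h], and
    [4 * h + 8 < 2 ^ h] absorbs the linear terms. Otherwise [0 < v] forces [y = w = h], [v = 1] and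
    [n] odd, and then the opposite signs of [e] in the two bounds decide. *)
Lemma balanced_card_bound n a b e y v w :
  17 < n -> y + v + w = n -> 0 < v -> e <= 1 ->
  a <= e + 2 ^ y + v -> b + e <= 1 + 2 ^ w + v ->
  minn a b <= minn (2 ^ n./2 + 1) (2 ^ (n - n./2) - 2).
Proof.
move=> n18 yvw v0 e1 la lb.
set h := n./2; have nE : n = odd n + h.*2 by rewrite odd_double_half.
have oddn : odd n <= 1 by case: (odd n).
have h9 : 8 < h by lia.
have pow : 2 * (2 ^ h.-1) = 2 ^ h by rewrite -expnS prednK //; lia.
have big k : 8 < k -> 4 * k + 8 < 2 ^ k.
  elim: k => // k IH; rewrite leq_eqVlt => /orP[/eqP <- //|k8].
  by rewrite expnS; have := IH k8; lia.
have {}big := big _ h9.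
have le_n : 2 ^ h <= 2 ^ (n - h) by rewrite leq_exp2l //; lia.
have powle c : c < h -> 2 ^ c <= 2 ^ h.-1 by move=> ch; rewrite leq_exp2l //; lia.
have [yh|hy] := ltnP y h; first by have := powle _ yh; lia.
have [wh|hw] := ltnP w h; first by have := powle _ wh; lia.
have yE : y = h by lia.
have wE : w = h by lia.
have -> : n - h = h.+1 by lia.
move: la lb; rewrite yE wE expnS; lia.
Qed.

Lemma cardsU_le (T : finType) (A B : {set T}) : #|A :|: B| <= #|A| + #|B|.
Proof. by rewrite cardsU leq_subr. Qed.

(** The bound is the one attained in [Fpcol_lower_bound], so a pair of families containing an atom
    pair never beats the cross-comparable construction. *)
Lemma near_cross_atom_card n (A B : {set {set 'I_n}}) (u : 'I_n) :
  17 < n -> [disjoint A & B] -> near_cross A B ->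
  [set u] \in A -> ~: [set u] \in B ->
  minn #|A| #|B| <= minn (2 ^ n./2 + 1) (2 ^ (n - n./2) - 2).
Proof.
move=> n18 dAB AB uA uB.
have [Y [V [uV dYV AYV BYV]]] := near_cross_atom_structure dAB AB uA uB.
set sV := [set [set v] | v in V] in AYV; set cV := [set ~: [set v] | v in V] in BYV.
set up := [set Z | _] in BYV.
have sVV : #|sV| <= #|V| by apply: leq_imset_card.
have cVV : #|cV| <= #|V| by apply: leq_imset_card.
have V0 : 0 < #|V| by rewrite card_gt0; apply/set0Pn; exists u.
pose w := #|~: (Y :|: V)|.
have yvw : #|Y| + #|V| + w = n.
  have := cardsC (Y :|: V); rewrite card_ord.
  by rewrite cardsU disjoint_setI0 // cards0 subn0.
have upw : #|up| = 2 ^ w by rewrite card_supersets.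
(* [setT] lies in at most one of the disjoint families: [e] adds to the bound for [A] and is taken
   off the [2 ^ w] supersets available to [B]. *)
pose e := nat_of_bool (setT \in A).
have cA : #|A| <= e + 2 ^ #|Y| + #|V|.
  have : A \subset [set X in A | X == setT] :|: (powerset Y :|: sV).
    apply/fintype.subsetP => S SA; move: (fintype.subsetP AYV S SA).
    by rewrite !inE SA.
  move=> /subset_leq_card/leq_trans; apply.
  apply: leq_trans (cardsU_le _ _) _; rewrite -addnA leq_add //; last first.
    by apply: leq_trans (cardsU_le _ _) _; rewrite card_powerset leq_add2l.
  have : [set X in A | X == setT] \subset (if setT \in A then [set setT] else set0).
    apply/fintype.subsetP => X; rewrite inE => /andP[XA /eqP XT].
    by rewrite XT in XA *; rewrite XA inE.
  by move=> /subset_leq_card/leq_trans; apply; rewrite /e; case: ifP; rewrite ?cards1 ?cards0.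
have cB : #|B| + e <= 1 + 2 ^ w + #|V|.
  pose up' := if setT \in A then up :\ setT else up.
  have up'w : #|up'| + e = 2 ^ w.
    rewrite -upw /up' /e; case: ifP; rewrite ?addn0 // => _.
    by rewrite [in RHS](cardsD1 setT) addnC inE subsetT.
  have : B \subset set0 |: (up' :|: cV).
    apply/fintype.subsetP => Z ZB; move: (fintype.subsetP BYV Z ZB).
    rewrite !inE /up'; case: ifP => TA; rewrite !inE //.
    suff -> : Z != setT by [].
    by apply: contraTneq ZB => ->; rewrite (disjointFr dAB).
  move=> /subset_leq_card BU; have {BU} : #|B| <= 1 + (#|up'| + #|V|).
    apply: leq_trans BU _; apply: leq_trans (cardsU_le _ _) _; rewrite cards1 leq_add2l.
    by apply: leq_trans (cardsU_le _ _) _; rewrite leq_add2l.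
  by rewrite -up'w; lia.
apply: balanced_card_bound n18 yvw V0 _ cA cB.
by rewrite /e; case: (_ \in _).
Qed.

Lemma comparable_classes_no_rainbow n k (phi : pcoloring n k) (i j : 'I_k) :
  i != j ->
  (forall S T, S \in color_class phi i -> T \in color_class phi j -> cmp S T) ->
  ~~ strong_rainbow phi.
Proof.
move=> ij cr; apply/strong_rainbowP => -[f fK inc].
by move/negP: (inc _ _ ij); apply; apply: cr; rewrite inE fK.
Qed.

Lemma no_rainbow_comparable_classes n (phi : pcoloring n 2) (S T : {set 'I_n}) :
  ~~ strong_rainbow phi -> S \in color_class phi ord0 ->
  T \in color_class phi ord_max -> cmp S T.
Proof.
rewrite !inE => nr /eqP Si /eqP Tj; apply: contraR nr => nST.
have ord2 (i : 'I_2) : i != ord0 -> i = ord_max.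
  by case: i => [[|[|//]] i2] // _; apply: val_inj.
apply/strong_rainbowP; exists (fun i => if i == ord0 then S else T) => [i|i j].
  by have [->|/ord2 ->] := eqVneq i ord0.
have [i0|/ord2 i0] := eqVneq i ord0; have [j0|/ord2 j0] := eqVneq j ord0;
  by rewrite ?i0 ?j0 ?eqxx // cmpC.
Qed.

(** * Colourings built from a pair of families, and the extremal pair *)

Definition pcoloring_of n (A B : {set {set 'I_n}}) : pcoloring n 2 :=
  [ffun S => if S \in A then Some ord0 else if S \in B then Some ord_max else None].

Definition coloring_of n (A B : {set {set 'I_n}}) : coloring n 3 :=
  [ffun S => if S \in A then ord0 else if S \in B then inord 1 else ord_max].

Lemma pcoloring_of_class n (A B : {set {set 'I_n}}) (i : 'I_2) :
  [disjoint A & B] ->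
  color_class (pcoloring_of A B) i = if i == ord0 then A else B.
Proof.
move=> dAB; apply/setP => S; rewrite inE ffunE.
case: i => [[|[|//]] i2]; rewrite -(inj_eq val_inj) /=.
  by case: (S \in A) => //; case: (S \in B).
by case: (boolP (S \in A)) => [/(disjointFr dAB) -> //|_]; case: (S \in B).
Qed.

Lemma coloring_of_class n (A B : {set {set 'I_n}}) (i : 'I_3) :
  [disjoint A & B] ->
  color_class (partial_of (coloring_of A B)) i =
  if i == ord0 then A else if i == inord 1 then B else ~: (A :|: B).
Proof.
move=> dAB; apply/setP => S; rewrite inE !ffunE.
rewrite -!(inj_eq val_inj) /= inordK // (inj_eq (@Some_inj _)) -(inj_eq val_inj).
case: i => [[|[|[|//]]] i3] /=; rewrite ?inE.
- by case: (S \in A) => //; case: (S \in B); rewrite //= inordK.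
- by case: (boolP (S \in A)) => [/(disjointFr dAB) -> //|_]; case: (S \in B); rewrite //= inordK.
- by case: (S \in A) => //; case: (S \in B); rewrite //= inordK.
Qed.

Lemma cross_comparable_no_rainbow n (A B : {set {set 'I_n}}) :
  [disjoint A & B] -> (forall S T, S \in A -> T \in B -> cmp S T) ->
  ~~ strong_rainbow (pcoloring_of A B) /\
  ~~ strong_rainbow (partial_of (coloring_of A B)).
Proof.
move=> dAB AB; split.
  apply: (@comparable_classes_no_rainbow _ _ _ ord0 ord_max) => // S T.
  by rewrite !pcoloring_of_class //; apply: AB.
have ne : inord 1 != ord0 :> 'I_3 by rewrite -(inj_eq val_inj) /= inordK.
apply: (@comparable_classes_no_rainbow _ _ _ ord0 (inord 1)); first by rewrite eq_sym.
by move=> S T; rewrite !coloring_of_class // (negPf ne) !eqxx; apply: AB.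
Qed.

(** The extremal pair. [setT] is comparable to everything, so it may join the lower family; that
    family then holds both trivial sets. *)
Definition lower_family n (Y : {set 'I_n}) := setT |: powerset Y.
Definition upper_family n (Y : {set 'I_n}) := [set Z : {set 'I_n} | Y \proper Z] :\ setT.

Lemma lower_upper_disjoint n (Y : {set 'I_n}) :
  [disjoint lower_family Y & upper_family Y].
Proof.
rewrite disjoint_subset; apply/fintype.subsetP => S; rewrite !inE.
move=> /orP[-> //|SY]; apply/negP => /andP[_ YS].
by have := proper_sub_trans YS SY; rewrite properxx.
Qed.

Lemma lower_upper_cmp n (Y S T : {set 'I_n}) :
  S \in lower_family Y -> T \in upper_family Y -> cmp S T.
Proof.
rewrite !inE => /orP[/eqP ->|SY] /andP[_ /proper_sub YT].
  by rewrite /cmp subsetT orbT.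
by rewrite /cmp (fintype.subset_trans SY YT).
Qed.

Lemma card_lower_family n (Y : {set 'I_n}) :
  #|Y| < n -> #|lower_family Y| = 2 ^ #|Y| + 1.
Proof.
move=> Yn; rewrite cardsU1 card_powerset addnC inE subTset.
suff -> : (Y == setT) = false by [].
by apply: contraTF Yn => /eqP ->; rewrite cardsT card_ord ltnn.
Qed.

Lemma card_setC_ord n (X : {set 'I_n}) : #|~: X| = n - #|X|.
Proof. by rewrite cardsCs setCK card_ord. Qed.

Lemma card_upper_family n (Y : {set 'I_n}) :
  #|upper_family Y| >= 2 ^ (n - #|Y|) - 2.
Proof.
rewrite -card_setC_ord -card_supersets (cardsD1 Y) inE fintype.subxx.
have -> : [set Z : {set 'I_n} | Y \subset Z] :\ Y = [set Z : {set 'I_n} | Y \proper Z].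
  by apply/setP => Z; rewrite !inE properEneq eq_sym.
rewrite (cardsD1 setT) -/(upper_family Y); case: (_ \in _); lia.
Qed.

Lemma Fpcol_lower_bound n :
  1 < n -> minn (2 ^ n./2 + 1) (2 ^ (n - n./2) - 2) < Fpcol n 2.
Proof.
move=> n1; rewrite /Fpcol; case: ex_minnP => m /forallP mP _.
rewrite ltnNge; apply/negP => le_m.
have hn : n./2 < n by lia.
have [Y [_ _ Yh]] : exists U : {set 'I_n}, [/\ set0 \subset U, U \subset setT & #|U| = n./2].
  by apply: exists_set_between; rewrite ?sub0set // cards0 cardsT card_ord leq0n /= ltnW.
have d := lower_upper_disjoint Y.
have [/negP nr _] := cross_comparable_no_rainbow d (@lower_upper_cmp _ Y).
apply: nr; apply: (implyP (mP _)); apply/forallP => i; rewrite pcoloring_of_class //.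
apply: leq_trans le_m _; case: ifP => _.
  by rewrite card_lower_family Yh // geq_minl.
by apply: leq_trans (card_upper_family Y); rewrite Yh geq_minr.
Qed.

(** This leaves room for a third colour class as large as the smaller of the two. A member [X] of
    [A] of middle size confines [B] to the subsets and supersets of [X], at most [4 + 2 ^ (n - 2)]
    by convexity; without one, [A] has only trivial sets, atoms and coatoms. *)
Lemma cross_comparable_card n (A B : {set {set 'I_n}}) :
  5 < n -> (forall S T, S \in A -> T \in B -> cmp S T) ->
  3 * minn #|A| #|B| <= 2 ^ n.
Proof.
move=> n5 AB.
have [[X XA /andP[X1 Xn]]|small] := pselect (exists2 X, X \in A & 1 < #|X| < n.-1).
  have BX : B \subset powerset X :|: [set Z : {set 'I_n} | X \subset Z].
    by apply/fintype.subsetP => T TB; rewrite !inE orbC; apply: AB.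
  have {BX} : #|B| <= 2 ^ #|X| + 2 ^ (n - #|X|).
    apply: leq_trans (subset_leq_card BX) _; apply: leq_trans (cardsU_le _ _) _.
    by rewrite card_powerset card_supersets card_setC_ord.
  have pow2 a b : 1 < a -> 1 < b -> 2 ^ a + 2 ^ b <= 4 + 2 ^ (a + b - 2).
    move=> a1 b1; rewrite -(subnKC a1) -(subnKC b1).
    move: (a - 2) (b - 2) => c d.
    have -> : 2 + c + (2 + d) - 2 = 2 + (c + d) by lia.
    rewrite !expnD.
    have := expn_gt0 2 c; have := expn_gt0 2 d; rewrite /=; nia.
  have := pow2 #|X| (n - #|X|) X1; rewrite subnKC; last lia.
  have : 2 ^ n = 4 * 2 ^ (n - 2) by rewrite -(expnD 2 2); congr (_ ^ _); lia.
  have : 2 ^ 4 <= 2 ^ (n - 2) by rewrite leq_exp2l //; lia.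
  move: (2 ^ n) (2 ^ (n - 2)) (2 ^ #|X|) (2 ^ (n - #|X|)) => *; lia.
pose atoms := [set [set u] | u : 'I_n]; pose coatoms := [set ~: [set u] | u : 'I_n].
have AX : A \subset (set0 |: atoms) :|: (setT |: coatoms).
  apply/fintype.subsetP => X XA; rewrite inE.
  have [X1|X1] := leqP #|X| 1; apply/orP; [left|right].
    rewrite inE; move: X1; rewrite leq_eqVlt ltnS leqn0 cards_eq0 inE.
    move=> /orP[/cards1P[u ->]|-> //]; by rewrite imset_f ?orbT.
  have : #|~: X| <= 1.
    rewrite card_setC_ord.
    have : ~ (1 < #|X| < n.-1) by move=> H; apply: small; exists X.
    by rewrite X1 => /negP; rewrite -leqNgt; lia.
  rewrite inE leq_eqVlt ltnS leqn0 cards_eq0 inE.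
  move=> /orP[/cards1P[u E]|/eqP E].
    by rewrite -[X]setCK E (imset_f (fun u => ~: [set u])) ?orbT.
  by rewrite -[X]setCK E setC0 eqxx.
have [aC cC] : #|atoms| <= n /\ #|coatoms| <= n.
  by split; apply: leq_trans (leq_imset_card _ _) _; rewrite card_ord.
have {AX} : #|A| <= (1 + n) + (1 + n).
  apply: leq_trans (subset_leq_card AX) _; apply: leq_trans (cardsU_le _ _) _.
  by apply: leq_add; apply: leq_trans (cardsU_le _ _) _; rewrite cards1 leq_add2l.
have : 3 * (2 * n + 2) <= 2 ^ n.
  elim: n n5 {A B AB small atoms coatoms aC cC} => // k IH.
  rewrite leq_eqVlt => /orP[/eqP <- //|k5]; rewrite expnS; have := IH k5; lia.
lia.
Qed.

Lemma Fcol3_eq_Fpcol2 n : 17 < n -> Fcol n 3 = Fpcol n 2.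
Proof.
move=> n18; have lb := @Fpcol_lower_bound n ltac:(lia).
apply/eqP; rewrite eqn_leq; apply/andP; split.
  (* The value [Fpcol n 2] works for three colours: a cross-comparable pair of classes is turned
     into a partial two-colouring, while an atom pair or a class of at most four sets contradicts
     [lb]. *)
  rewrite /Fcol; case: ex_minnP => m _; apply.
  move: lb; rewrite /Fpcol; case: ex_minnP => {}m /forallP mP _ lb.
  apply/forallP => phi; apply/implyP => /forallP big; apply: contraT => nr.
  have disj i j : i != j ->
      [disjoint color_class (partial_of phi) i & color_class (partial_of phi) j].
    move=> ij; rewrite disjoint_subset; apply/fintype.subsetP => S; rewrite !inE => /eqP ->.
    by apply: contra ij => /eqP[->].
  have [||[i [j [ij nc]]]|[l [T [_ sub]]]] := @three_coloring_structure n n./2 phi _ _ nr; [lia|lia| |].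
    have d := disj i j ij.
    have [cr|[[u [uA uB]]|[u [uA uB]]]] := near_cross_cmp nc.
    - have [+ _] := cross_comparable_no_rainbow d cr; move=> /negP[].
      by apply: (implyP (mP _)); apply/forallP => c; rewrite pcoloring_of_class //; case: ifP.
    - have := near_cross_atom_card n18 d nc uA uB.
      by have := big i; have := big j; lia.
    - have := near_cross_atom_card n18 (disj j i _) (near_crossC nc) uA uB.
      by rewrite eq_sym ij => /(_ isT); have := big i; have := big j; lia.
  have m4 : m <= 4.
    apply: leq_trans (big l) _; apply: leq_trans (subset_leq_card sub) _.
    do 2 (apply: leq_trans (cardsU_le _ _) _; rewrite cards1 addn1 ltnS).
    by apply: leq_trans (cardsU_le _ _) _; rewrite !cards1.
  have : 2 ^ 9 <= 2 ^ n./2 by rewrite leq_exp2l //; lia.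
  have : 2 ^ 9 <= 2 ^ (n - n./2) by rewrite leq_exp2l //; lia.
  lia.
(* Conversely, the two classes of a partial colouring are cut down to exactly [m] sets each and all
   other sets receive the third colour; [cross_comparable_card] makes that class large enough. *)
rewrite /Fpcol; case: ex_minnP => m _; apply.
rewrite /Fcol; case: ex_minnP => {lb}m /forallP mP _.
apply/forallP => phi; apply/implyP => /forallP big; apply: contraT => nr.
have cr := no_rainbow_comparable_classes nr.
have sub (C : {set {set 'I_n}}) : m <= #|C| -> exists2 D : {set {set 'I_n}}, D \subset C & #|D| = m.
  move=> /card_geqP[s [us <- sC]]; exists [set x in s].
    by apply/fintype.subsetP => x; rewrite inE => /sC.
  by rewrite cardsE; apply/card_uniqP.
have [A A0 Am] := sub _ (big ord0); have [B B1 Bm] := sub _ (big ord_max).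
have AB S T : S \in A -> T \in B -> cmp S T.
  by move=> /(fintype.subsetP A0) SA /(fintype.subsetP B1) TB; apply: cr.
have d : [disjoint A & B].
  rewrite disjoint_subset; apply/fintype.subsetP => S /(fintype.subsetP A0).
  rewrite !inE => /eqP E; apply/negP => /(fintype.subsetP B1); rewrite inE E.
  by case/eqP.
have [_ /negP[]] := cross_comparable_no_rainbow d AB.
apply: (implyP (mP _)); apply/forallP => c; rewrite coloring_of_class //.
case: ifP => _; first by rewrite Am.
case: ifP => _; first by rewrite Bm.
have := @cross_comparable_card n A B ltac:(lia) AB; rewrite Am Bm minnn.
rewrite cardsCs setCK cardsU disjoint_setI0 // cards0 Am Bm.
have -> : #|{: {set 'I_n}}| = 2 ^ n by rewrite -cardsT -powersetT card_powerset cardsT card_ord.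
lia.
Qed.

Local Open Scope ring_scope.

(** * Lubell mass *)

Lemma lubell_ge0 (R : realType) n (A : {set {set 'I_n}}) : 0 <= lubell R A.
Proof. by apply: sumr_ge0 => S _; rewrite invr_ge0 ler0n. Qed.

Lemma lubell_subset (R : realType) n (A B : {set {set 'I_n}}) :
  A \subset B -> lubell R A <= lubell R B.
Proof.
move=> AB; rewrite /lubell [leRHS](big_setID A) /= (setIidPr AB) lerDl.
exact: lubell_ge0.
Qed.

Lemma lubellU_le (R : realType) n (A B : {set {set 'I_n}}) :
  lubell R (A :|: B) <= lubell R A + lubell R B.
Proof.
have -> : lubell R (A :|: B) = lubell R A + lubell R (B :\: A).
  by rewrite /lubell (big_setID A) /= setUK setDUl setDv set0U.
by rewrite lerD2l lubell_subset // subsetDl.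
Qed.

Lemma lubell1 (R : realType) n (S : {set 'I_n}) :
  lubell R [set S] = ('C(n, #|S|)%:R)^-1.
Proof. by rewrite /lubell big_set1. Qed.

Lemma lubell_imset_card (R : realType) n (V : {set 'I_n}) (f : 'I_n -> {set 'I_n}) :
  (forall v, 'C(n, #|f v|) = n) -> lubell R [set f v | v in V] <= #|V|%:R / n%:R.
Proof.
move=> fn; rewrite /lubell (eq_bigr (fun=> n%:R^-1)); last first.
  by move=> _ /imsetP[v _ ->]; rewrite fn.
rewrite sumr_const -[leLHS]mulr_natl ler_wpM2r ?invr_ge0 ?ler0n // ler_nat.
exact: leq_imset_card.
Qed.

Definition subcube n (P Q : {set 'I_n}) : {set {set 'I_n}} :=
  [set S : {set 'I_n} | (P \subset S) && (S \subset Q)].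

(* Both sides satisfy the recursion obtained by deciding the membership of a
   fixed element of [Q :\: P]; the right-hand side is the Beta integral
   [(n + 1) * \int t ^ p * (1 - t) ^ q]. *)
Lemma lubell_subcube (R : realType) n (P Q : {set 'I_n}) : P \subset Q ->
  lubell R (subcube P Q) =
  n.+1%:R * (#|P|)`!%:R * (#|~: Q|)`!%:R / (#|P| + #|~: Q|).+1`!%:R.
Proof.
have [m] := ubnP #|Q :\: P|; elim: m P Q => // m IHm P Q; rewrite ltnS => QPm PQ.
have fact_neq0 k : k`!%:R != 0 :> R by rewrite pnatr_eq0 -lt0n fact_gt0.
have [QP|[x]] := set_0Vmem (Q :\: P).
  have {}PQ : P = Q.
    by apply/eqP; rewrite eqEsubset PQ -setD_eq0 QP eqxx.
  have -> : subcube P Q = [set P].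
    by apply/setP => S; rewrite !inE PQ -eqEsubset eq_sym.
  have le_Pn : (#|Q| <= n)%N by rewrite -[leqRHS]card_ord max_card.
  rewrite lubell1 -PQ card_setC_ord PQ subnKC // factS -(bin_fact le_Pn) !natrM.
  have Cn0 : 'C(n, #|Q|)%:R != 0 :> R by rewrite pnatr_eq0 -lt0n bin_gt0.
  have n0 : n.+1%:R != 0 :> R by rewrite pnatr_eq0.
  have aux (a b c d : R) : a != 0 -> b != 0 -> c != 0 -> d != 0 ->
    d^-1 = a * b * c / (a * (d * (b * c))).
    by move=> a0 b0 c0 d0; field; rewrite a0 b0 c0 d0.
  exact: aux.
rewrite inE => /andP[xP xQ].
have cP : #|x |: P| = #|P|.+1 by rewrite cardsU1 xP.
have cQ : #|~: (Q :\ x)| = #|~: Q|.+1.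
  by rewrite setCD setUC cardsU1 inE xQ.
have -> : lubell R (subcube P Q) =
    lubell R (subcube (x |: P) Q) + lubell R (subcube P (Q :\ x)).
  rewrite /lubell (bigID (fun S : {set 'I_n} => x \in S)) /=; congr (_ + _);
  apply: eq_bigl => S; rewrite !inE.
    by rewrite subUset sub1set; case: (x \in S); rewrite ?andbF ?andbT.
  by rewrite subsetD1 andbA.
have lt_m : (#|Q :\: P| = #|(Q :\: P) :\ x|.+1)%N by rewrite (cardsD1 x (Q :\: P)) inE xP xQ.
rewrite !IHm.
- rewrite cP cQ addSn addnS !factS !natrM.
  have s1 : (#|P| + #|~: Q|).+1%:R != 0 :> R by rewrite pnatr_eq0.
  have s2 : (#|P| + #|~: Q|).+2%:R != 0 :> R by rewrite pnatr_eq0.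
  have aux (N a b p q s t u : R) : s != 0 -> t != 0 -> u != 0 -> p + q = u ->
      N * a * b / (s * t) =
      N * (p * a) * b / (u * (s * t)) + N * a * (q * b) / (u * (s * t)).
    by move=> s0 t0 u0 pq; rewrite -pq in u0 *; field; rewrite s0 t0 u0.
  by apply/esym/aux => //; rewrite -natrD addSn addnS.
- apply: leq_trans QPm; rewrite lt_m ltnS; apply: subset_leq_card.
  by apply/fintype.subsetP => y; rewrite !inE => /and3P[-> -> ->].
- by rewrite subsetD1 PQ xP.
- apply: leq_trans QPm; rewrite lt_m ltnS; apply: subset_leq_card.
  by apply/fintype.subsetP => y; rewrite !inE negb_or => /andP[/andP[-> ->] ->].
- by rewrite subUset sub1set xQ.
Qed.

Lemma lubell_powerset (R : realType) n (Y : {set 'I_n}) :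
  lubell R (powerset Y) = n.+1%:R / #|~: Y|.+1%:R.
Proof.
have -> : powerset Y = subcube set0 Y.
  by apply/setP => S; rewrite !inE sub0set.
rewrite lubell_subcube ?sub0set // cards0 fact0 mulr1 add0n factS natrM.
have f0 : (#|~: Y|)`!%:R != 0 :> R by rewrite pnatr_eq0 -lt0n fact_gt0.
by rewrite -mulf_div divff // mulr1.
Qed.

Lemma lubell_supersets (R : realType) n (Y : {set 'I_n}) :
  lubell R [set Z : {set 'I_n} | Y \subset Z] = n.+1%:R / #|Y|.+1%:R.
Proof.
have -> : [set Z : {set 'I_n} | Y \subset Z] = subcube Y setT.
  by apply/setP => S; rewrite !inE subsetT andbT.
rewrite lubell_subcube ?subsetT // setCT cards0 fact0 mulr1 addn0 factS natrM.
have f0 : (#|Y|)`!%:R != 0 :> R by rewrite pnatr_eq0 -lt0n fact_gt0.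
by rewrite -mulf_div divff // mulr1.
Qed.

Lemma lubellD1 (R : realType) n (A : {set {set 'I_n}}) S :
  S \in A -> lubell R A = ('C(n, #|S|)%:R)^-1 + lubell R (A :\ S).
Proof. by move=> SA; rewrite /lubell (big_setD1 S). Qed.

Lemma lubell_powerset0 (R : realType) n (Y : {set 'I_n}) :
  lubell R (powerset Y :\ set0) = #|Y|%:R / (n - #|Y|).+1%:R.
Proof.
have Yn : (#|Y| <= n)%N by rewrite -[leqRHS]card_ord max_card.
have := @lubellD1 R n (powerset Y) set0; rewrite inE sub0set => /(_ isT).
rewrite lubell_powerset cards0 bin0 card_setC_ord invr1 => /esym/(canRL (addKr _)) ->.
have s0 : (n - #|Y|).+1%:R != 0 :> R by rewrite pnatr_eq0.
have -> : n.+1%:R = #|Y|%:R + (n - #|Y|).+1%:R :> R by rewrite -natrD addnS subnKC.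
by rewrite mulrDl divff // addrCA addNr addr0.
Qed.

Lemma lubell_supersetsT (R : realType) n (Y : {set 'I_n}) :
  lubell R ([set Z : {set 'I_n} | Y \subset Z] :\ setT) = (n - #|Y|)%:R / #|Y|.+1%:R.
Proof.
have Yn : (#|Y| <= n)%N by rewrite -[leqRHS]card_ord max_card.
have := @lubellD1 R n [set Z : {set 'I_n} | Y \subset Z] setT.
rewrite inE subsetT => /(_ isT).
rewrite lubell_supersets cardsT card_ord binn invr1 => /esym/(canRL (addKr _)) ->.
have s0 : #|Y|.+1%:R != 0 :> R by rewrite pnatr_eq0.
have -> : n.+1%:R = (n - #|Y|)%:R + #|Y|.+1%:R :> R by rewrite -natrD addnS subnK.
by rewrite mulrDl divff // addrCA addNr addr0.
Qed.

(** Raising the interval to start at a single point [x] of [P] gives mass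
    [(n + 1) / ((q + 2) * (q + 1))] with [q] the size of [~: Q]. As [q] is at least [n / 8], this is
    of order [1 / n], with constant [8 ^ 2]. *)
Lemma lubell_subcube_lower_small (R : realType) n (P Q : {set 'I_n}) :
  P != set0 -> (n <= 8 * #|~: Q|)%N -> (0 < n)%N ->
  lubell R (subcube P Q) <= 64 / n%:R.
Proof.
move=> /set0Pn[x xP] nQ n0.
have nR : 0 < n%:R :> R by rewrite ltr0n.
have [xQ|xQ] := boolP (x \in Q); last first.
  suff -> : subcube P Q = set0 by rewrite /lubell big_set0 divr_ge0 ?ler0n.
  apply/setP => S; rewrite !inE; apply: contraNF xQ => /andP[PS SQ].
  by rewrite (fintype.subsetP SQ) // (fintype.subsetP PS).
have sub : subcube P Q \subset subcube [set x] Q.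
  apply/fintype.subsetP => S; rewrite !inE => /andP[PS ->].
  by rewrite sub1set (fintype.subsetP PS).
apply: le_trans (lubell_subset R sub) _; rewrite lubell_subcube ?sub1set //.
rewrite cards1 factS fact0 muln1 mulr1 add1n !factS !natrM; set q := #|_| in nQ *.
have f0 : q`!%:R != 0 :> R by rewrite pnatr_eq0 -lt0n fact_gt0.
have -> : n.+1%:R * q`!%:R / (q.+2%:R * (q.+1%:R * q`!%:R)) =
    n.+1%:R / (q.+2%:R * q.+1%:R) :> R.
  by rewrite mulrA -mulf_div divff // mulr1.
rewrite ler_pdivrMr ?mulr_gt0 ?ltr0n // mulrAC ler_pdivlMr //.
rewrite -!natrM ler_nat; nia.
Qed.

(** Dual: the interval is enlarged to end at the complement of a point outside [Q]. *)
Lemma lubell_subcube_upper_small (R : realType) n (P Q : {set 'I_n}) :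
  Q != setT -> (n <= 8 * #|P|)%N -> (0 < n)%N ->
  lubell R (subcube P Q) <= 64 / n%:R.
Proof.
rewrite -properT => /properP[_ [x _ xQ]] nP n0.
have nR : 0 < n%:R :> R by rewrite ltr0n.
have [xP|xP] := boolP (x \in P).
  suff -> : subcube P Q = set0 by rewrite /lubell big_set0 divr_ge0 ?ler0n.
  apply/setP => S; rewrite !inE; apply: contraNF xQ => /andP[PS SQ].
  by rewrite (fintype.subsetP SQ) // (fintype.subsetP PS).
have sub : subcube P Q \subset subcube P (~: [set x]).
  apply/fintype.subsetP => S; rewrite !inE => /andP[-> SQ] /=.
  rewrite -setCS setCK sub1set inE; apply: contra xQ; exact: (fintype.subsetP SQ).
apply: le_trans (lubell_subset R sub) _; rewrite lubell_subcube; last first.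
  by rewrite -setCS setCK sub1set inE.
rewrite setCK cards1 factS fact0 muln1 mulr1 addn1 !factS !natrM; set q := #|_| in nP *.
have f0 : q`!%:R != 0 :> R by rewrite pnatr_eq0 -lt0n fact_gt0.
have -> : n.+1%:R * q`!%:R / (q.+2%:R * (q.+1%:R * q`!%:R)) =
    n.+1%:R / (q.+2%:R * q.+1%:R) :> R.
  by rewrite mulrA -mulf_div divff // mulr1.
rewrite ler_pdivrMr ?mulr_gt0 ?ltr0n // mulrAC ler_pdivlMr //.
rewrite -!natrM ler_nat; nia.
Qed.

Lemma card_ord_le n (Y : {set 'I_n}) : (#|Y| <= n)%N.
Proof. by rewrite -[leqRHS]card_ord max_card. Qed.

Lemma near_cross_atom_lubell (R : realType) n (A B : {set {set 'I_n}}) (u : 'I_n) :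
  [disjoint A & B] -> near_cross A B -> [set u] \in A -> ~: [set u] \in B ->
  setT \notin A -> set0 \notin A -> setT \notin B -> set0 \notin B ->
  exists x : R, [/\ 0 < x, lubell R A <= x & lubell R B <= x^-1].
Proof.
move=> dAB AB uA uB TA A0 TB B0.
have [Y [V [uV dYV AYV BYV]]] := near_cross_atom_structure dAB AB uA uB.
set sV := [set [set v] | v in V] in AYV; set cV := [set ~: [set v] | v in V] in BYV.
have n0 : (0 < n)%N by apply: leq_trans (ltn_ord u).
have v0 : (0 < #|V|)%N by rewrite card_gt0; apply/set0Pn; exists u.
have cYV : #|Y :|: V| = (#|Y| + #|V|)%N by rewrite cardsU disjoint_setI0 // cards0 subn0.
have yvn : (#|Y| + #|V| <= n)%N by rewrite -cYV card_ord_le.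
have lA : lubell R A <= #|Y|%:R / (n - #|Y|).+1%:R + #|V|%:R / n%:R.
  have sub : A \subset (powerset Y :\ set0) :|: sV.
    apply/fintype.subsetP => S SA; have := fintype.subsetP AYV S SA; rewrite !inE.
    have [E|_] := eqVneq S setT; first by rewrite -E SA in TA.
    by have [E|_] := eqVneq S set0; first by rewrite -E SA in A0.
  apply: le_trans (lubell_subset R sub) _; apply: le_trans (lubellU_le _ _ _) _.
  rewrite lubell_powerset0 lerD2l; apply: lubell_imset_card => v.
  by rewrite cards1 bin1.
have lB : lubell R B <= (n - (#|Y| + #|V|))%:R / (#|Y| + #|V|).+1%:R + #|V|%:R / n%:R.
  have sub : B \subset ([set Z : {set 'I_n} | Y :|: V \subset Z] :\ setT) :|: cV.
    apply/fintype.subsetP => S SB; have := fintype.subsetP BYV S SB; rewrite !inE.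
    have [E|_] := eqVneq S set0; first by rewrite -E SB in B0.
    by have [E|_] := eqVneq S setT; first by rewrite -E SB in TB.
  apply: le_trans (lubell_subset R sub) _; apply: le_trans (lubellU_le _ _ _) _.
  rewrite lubell_supersetsT cYV lerD2l; apply: lubell_imset_card => v.
  by rewrite card_setC_ord cards1 bin_sub // bin1.
have pos k : (0 < k)%N -> 0 < k%:R :> R by rewrite ltr0n.
have yV : (0 < #|Y| + #|V|)%N by rewrite addn_gt0 v0 orbT.
have nY : (0 < n - #|Y|)%N by rewrite subn_gt0 (leq_trans _ yvn) // -addn1 leq_add2l.
have mono (k a b : nat) : (0 < b)%N -> (b <= a)%N -> k%:R / a%:R <= k%:R / b%:R :> R.
  move=> b0 ba; rewrite ler_wpM2l ?ler0n // lef_pV2 ?ler_nat ?posrE ?pos //.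
  exact: leq_trans ba.
(* With [y], [v] the sizes of [Y], [V], the [v / n] from the atoms is at most [v / (n - y)], and the
   [v / n] from the coatoms at most [v / (y + v)]. So both bounds hold without an error term for
   [x = (y + v) / (n - y)]. *)
exists ((#|Y| + #|V|)%:R / (n - #|Y|)%:R); split.
- by apply: divr_gt0; apply: pos.
- apply: le_trans lA _; rewrite natrD mulrDl; apply: lerD; apply: mono => //.
  exact: leq_subr.
apply: le_trans lB _; rewrite invf_div.
have -> : (n - #|Y| = (n - (#|Y| + #|V|)) + #|V|)%N.
  by rewrite subnDA subnK // leq_subRL // (leq_trans (leq_addr _ _) yvn).
by rewrite natrD mulrDl; apply: lerD; apply: mono.
Qed.

(** A smallest member [S] of the union is nonempty and lies below every member of the other family,
    which is thus confined to the interval from [S] to [Y], of mass of order [1 / n]. *)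
Lemma lower_families_small (R : realType) n (A B : {set {set 'I_n}}) (Y : {set 'I_n}) :
  [disjoint A & B] -> (forall S T, S \in A -> T \in B -> cmp S T) ->
  set0 \notin A -> set0 \notin B -> A \subset powerset Y -> B \subset powerset Y ->
  (n <= 8 * #|~: Y|)%N -> (0 < n)%N ->
  lubell R A <= 64 / n%:R \/ lubell R B <= 64 / n%:R.
Proof.
move=> dAB AB A0 B0 AY BY nY n0.
have above (C D : {set {set 'I_n}}) S0 : [disjoint C & D] ->
    (forall S T, S \in C -> T \in D -> cmp S T) -> set0 \notin C -> D \subset powerset Y ->
    S0 \in C -> (forall T, T \in D -> (#|S0| <= #|T|)%N) -> lubell R D <= 64 / n%:R.
  move=> dCD CD C0 DY SC minS.
  have sub : D \subset subcube S0 Y.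
    apply/fintype.subsetP => T TD; rewrite inE; have := fintype.subsetP DY T TD.
    rewrite inE => ->; rewrite andbT; have /orP[//|TS] := CD _ _ SC TD.
    have /eqP E : T == S0 by rewrite eqEcard TS minS.
    by move: (disjointFr dCD SC); rewrite -E TD.
  apply: le_trans (lubell_subset R sub) _; apply: lubell_subcube_lower_small => //.
  by apply: contraNneq C0 => <-.
have [AB0|[S0 S0AB]] := set_0Vmem (A :|: B).
  left; have -> : A = set0 by apply/eqP; rewrite -subset0 -AB0 subsetUl.
  by rewrite /lubell big_set0 divr_ge0 ?ler0n.
have [S /= SAB minS] := @arg_minnP _ S0 [pred S in A :|: B] (fun S : {set 'I_n} => #|S|) S0AB.
move: SAB; rewrite inE => /orP[SA|SB].
  by right; apply: (above A B S) => // T TB; apply: minS; rewrite inE TB orbT.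
left; apply: (above B A S) => //; first by rewrite disjoint_sym.
  by move=> X T XB TA; rewrite cmpC AB.
by move=> T TA; apply: minS; rewrite inE TA.
Qed.

(** Dual: a largest member of the union lies above the whole other family. *)
Lemma upper_families_small (R : realType) n (A B : {set {set 'I_n}}) (Y : {set 'I_n}) :
  [disjoint A & B] -> (forall S T, S \in A -> T \in B -> cmp S T) ->
  setT \notin A -> setT \notin B ->
  A \subset [set Z : {set 'I_n} | Y \subset Z] -> B \subset [set Z : {set 'I_n} | Y \subset Z] ->
  (n <= 8 * #|Y|)%N -> (0 < n)%N ->
  lubell R A <= 64 / n%:R \/ lubell R B <= 64 / n%:R.
Proof.
move=> dAB AB A0 B0 AY BY nY n0.
have below (C D : {set {set 'I_n}}) S0 : [disjoint C & D] ->
    (forall S T, S \in C -> T \in D -> cmp S T) -> setT \notin C ->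
    D \subset [set Z : {set 'I_n} | Y \subset Z] ->
    S0 \in C -> (forall T, T \in D -> (#|T| <= #|S0|)%N) -> lubell R D <= 64 / n%:R.
  move=> dCD CD C0 DY SC maxS.
  have sub : D \subset subcube Y S0.
    apply/fintype.subsetP => T TD; rewrite inE; have := fintype.subsetP DY T TD.
    rewrite inE => -> /=; have /orP[ST|//] := CD _ _ SC TD.
    have /eqP E : S0 == T by rewrite eqEcard ST maxS.
    by move: (disjointFr dCD SC); rewrite E TD.
  apply: le_trans (lubell_subset R sub) _; apply: lubell_subcube_upper_small => //.
  by apply: contraNneq C0 => <-.
have [AB0|[S0 S0AB]] := set_0Vmem (A :|: B).
  left; have -> : A = set0 by apply/eqP; rewrite -subset0 -AB0 subsetUl.
  by rewrite /lubell big_set0 divr_ge0 ?ler0n.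
have [S /= SAB maxS] := @arg_maxnP _ S0 [pred S in A :|: B] (fun S : {set 'I_n} => #|S|) S0AB.
move: SAB; rewrite inE => /orP[SA|SB].
  by right; apply: (below A B S) => // T TB; apply: maxS; rewrite inE TB orbT.
left; apply: (below B A S) => //; first by rewrite disjoint_sym.
  by move=> X T XB TA; rewrite cmpC AB.
by move=> T TA; apply: maxS; rewrite inE TA.
Qed.

(** * Cuts of a cross-comparable pair *)

Definition is_cut n (F : {set {set 'I_n}}) (Y : {set 'I_n}) : bool :=
  [forall S in F, cmp S Y].

Lemma cut_below n (A B : {set {set 'I_n}}) T :
  (forall S T, S \in A -> T \in B -> cmp S T) -> T \in B ->
  is_cut (A :|: B) (\bigcup_(S in A | S \subset T) S).
Proof.
move=> AB TB; apply/forall_inP => Q; rewrite inE => /orP[QA|QB].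
  have /orP[QT|TQ] := AB _ _ QA TB; apply/orP; [left|right].
    by apply: bigcup_sup; rewrite QA.
  by apply/bigcupsP => S /andP[_ /fintype.subset_trans]; apply.
(* For [Q] in [B]: either every member of [A] below [T] is also below [Q], and so is their union, or
   one of them is not, and then it contains [Q]. *)
have [sub|] := boolP [forall S in A, (S \subset T) ==> (S \subset Q)].
  apply/orP; right; apply/bigcupsP => S /andP[SA ST].
  by apply: (implyP (forall_inP sub S SA)).
move=> /forall_inPn[S SA]; rewrite negb_imply => /andP[ST nSQ].
have /orP[SQ|QS] := AB _ _ SA QB; first by rewrite SQ in nSQ.
by apply/orP; left; apply: fintype.subset_trans QS _; apply: bigcup_sup; rewrite SA.
Qed.

(** On each side of the cut one of the two families is negligible. If it is the same family twice,
    its whole mass is small; otherwise one family essentially lives below [Y] and the other above,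
    and [x] is the ratio of the sizes of [Y] and [~: Y] or its inverse. *)
Lemma central_cut_lubell (R : realType) n (A B : {set {set 'I_n}}) Y :
  [disjoint A & B] -> (forall S T, S \in A -> T \in B -> cmp S T) ->
  setT \notin A -> set0 \notin A -> setT \notin B -> set0 \notin B ->
  is_cut (A :|: B) Y -> (n <= 8 * #|Y|)%N -> (n <= 8 * #|~: Y|)%N -> (0 < n)%N ->
  [\/ lubell R A <= 128 / n%:R, lubell R B <= 128 / n%:R |
   exists x : R, [/\ 0 < x, lubell R A <= x + 64 / n%:R & lubell R B <= x^-1 + 64 / n%:R]].
Proof.
move=> dAB AB TA A0 TB B0 /forall_inP cut nY nYC n0.
pose low (C : {set {set 'I_n}}) := [set S in C | S \subset Y].
pose up (C : {set {set 'I_n}}) := [set S in C | ~~ (S \subset Y)].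
have split_le C : lubell R C <= lubell R (low C) + lubell R (up C).
  apply: le_trans (lubellU_le _ _ _); apply: lubell_subset.
  by apply/fintype.subsetP => S SC; rewrite !inE SC /=; case: (_ \subset _).
have subs (C : {set {set 'I_n}}) (p : pred {set 'I_n}) : [set S in C | p S] \subset C.
  by apply/fintype.subsetP => S; rewrite inE => /andP[].
have lowY (C : {set {set 'I_n}}) : set0 \notin C -> low C \subset powerset Y :\ set0.
  move=> C0; apply/fintype.subsetP => S; rewrite !inE => /andP[SC ->]; rewrite andbT.
  by apply: contraNneq C0 => <-.
have upY (C : {set {set 'I_n}}) : C \subset A :|: B -> setT \notin C ->
    up C \subset [set Z : {set 'I_n} | Y \subset Z] :\ setT.
  move=> CAB C0; apply/fintype.subsetP => S; rewrite !inE => /andP[SC nSY].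
  have := cut _ (fintype.subsetP CAB _ SC); rewrite /cmp (negPf nSY) /= => ->.
  by rewrite andbT; apply: contraNneq C0 => <-.
have dsub (p q : pred {set 'I_n}) : [disjoint [set S in A | p S] & [set S in B | q S]].
  apply: disjointWl (subs _ _) _; apply: disjointWr (subs _ _) _; exact: dAB.
have csub (p q : pred {set 'I_n}) S T : S \in [set S in A | p S] -> T \in [set S in B | q S] -> cmp S T.
  by move=> /(fintype.subsetP (subs _ _)) SA /(fintype.subsetP (subs _ _)); apply: AB.
have nin (C : {set {set 'I_n}}) (p : pred {set 'I_n}) S : S \notin C -> S \notin [set S in C | p S].
  by apply: contraNN; apply: (fintype.subsetP (subs _ _)).
have lA := lowY _ A0; have lB := lowY _ B0.
have uA := upY _ (subsetUl _ _) TA; have uB := upY _ (subsetUr _ _) TB.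
have smallL : lubell R (low A) <= 64 / n%:R \/ lubell R (low B) <= 64 / n%:R.
  apply: (@lower_families_small R n _ _ Y) => //;
    [exact: dsub|exact: csub|exact: nin|exact: nin|..].
    by apply: fintype.subset_trans lA (subsetDl _ _).
  by apply: fintype.subset_trans lB (subsetDl _ _).
have smallU : lubell R (up A) <= 64 / n%:R \/ lubell R (up B) <= 64 / n%:R.
  apply: (@upper_families_small R n _ _ Y) => //;
    [exact: dsub|exact: csub|exact: nin|exact: nin|..].
    by apply: fintype.subset_trans uA (subsetDl _ _).
  by apply: fintype.subset_trans uB (subsetDl _ _).
have Yn := card_ord_le Y; rewrite card_setC_ord in nYC.
have y0 : 0 < #|Y|%:R :> R by rewrite ltr0n lt0n; apply: contraTneq nY => ->; rewrite muln0 -ltnNge.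
have c0 : 0 < (n - #|Y|)%:R :> R by rewrite ltr0n lt0n; apply: contraTneq nYC => ->; rewrite muln0 -ltnNge.
have lowb (C : {set {set 'I_n}}) : set0 \notin C -> lubell R (low C) <= #|Y|%:R / (n - #|Y|)%:R.
  move=> /lowY/(lubell_subset R)/le_trans; apply; rewrite lubell_powerset0.
  by rewrite ler_wpM2l ?ler0n // lef_pV2 ?posrE ?ler_nat // ltr0n.
have upb (C : {set {set 'I_n}}) : C \subset A :|: B -> setT \notin C ->
    lubell R (up C) <= (n - #|Y|)%:R / #|Y|%:R.
  move=> CAB /(upY _ CAB)/(lubell_subset R)/le_trans; apply; rewrite lubell_supersetsT.
  by rewrite ler_wpM2l ?ler0n // lef_pV2 ?posrE ?ler_nat // ltr0n.
have sA := split_le A; have sB := split_le B.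
have -> : 128 / n%:R = 64 / n%:R + 64 / n%:R :> R by rewrite -mulrDl -natrD.
have [lAs|lBs] := smallL; have [uAs|uBs] := smallU.
- by constructor 1; apply: le_trans sA _; apply: lerD.
- constructor 3; exists ((n - #|Y|)%:R / #|Y|%:R); rewrite divr_gt0 // invf_div; split=> //.
    by apply: le_trans sA _; rewrite addrC lerD // upb // subsetUl.
  by apply: le_trans sB _; rewrite lerD // lowb.
- constructor 3; exists (#|Y|%:R / (n - #|Y|)%:R); rewrite divr_gt0 // invf_div; split=> //.
    by apply: le_trans sA _; rewrite lerD // lowb.
  by apply: le_trans sB _; rewrite addrC lerD // upb // subsetUr.
- by constructor 2; apply: le_trans sB _; apply: lerD.
Qed.

Lemma no_central_cut_lubell (R : realType) n (A B : {set {set 'I_n}}) :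
  (forall S T, S \in A -> T \in B -> cmp S T) ->
  setT \notin A -> set0 \notin A -> setT \notin B -> set0 \notin B -> (0 < n)%N ->
  (forall Y, is_cut (A :|: B) Y -> (8 * #|Y| < n)%N \/ (8 * #|~: Y| < n)%N) ->
  lubell R A <= 2 / 7 \/ lubell R B <= 2 / 7.
Proof.
move=> AB TA A0 TB B0 n0 nocut.
pose lowcut Y := is_cut (A :|: B) Y && (8 * #|Y| < n)%N.
pose upcut Y := is_cut (A :|: B) Y && (8 * #|~: Y| < n)%N.
have low0 : lowcut set0.
  rewrite /lowcut cards0 n0 andbT; apply/forall_inP => S _.
  by rewrite /cmp sub0set orbT.
have upT : upcut setT.
  rewrite /upcut setCT cards0 n0 andbT; apply/forall_inP => S _.
  by rewrite /cmp subsetT.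
(* [Y] is a largest cut among the small ones and [Z] a smallest among the large ones. A family with
   no member strictly between them has mass at most [1 / 7] on either side, since a size below
   [n / 8] is at most a seventh of its complement. *)
case: (arg_maxnP (fun S : {set 'I_n} => #|S|) low0) => Y /andP[cutY Yn] maxY.
case: (arg_minnP (fun S : {set 'I_n} => #|S|) upT) => Z /andP[cutZ Zn] minZ.
have middle (C : {set {set 'I_n}}) : C \subset A :|: B -> setT \notin C -> set0 \notin C ->
    lubell R C <= 2 / 7 \/ exists S, [/\ S \in C, Y \proper S & S \proper Z].
  move=> CAB TC C0.
  have [[S /andP[SC /andP[SY ZS]]]|none] :=
      pselect (exists S, (S \in C) && (~~ (S \subset Y) && ~~ (Z \subset S))).
    right; exists S; split=> //; rewrite properE ?SY ?ZS ?andbT.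
      have := forall_inP cutY _ (fintype.subsetP CAB _ SC).
      by rewrite /cmp (negPf SY).
    have := forall_inP cutZ _ (fintype.subsetP CAB _ SC).
    by rewrite /cmp (negPf ZS) orbF.
  left.
  have sub : C \subset (powerset Y :\ set0) :|: ([set X : {set 'I_n} | Z \subset X] :\ setT).
    apply/fintype.subsetP => S SC; rewrite !inE.
    have -> : S != set0 by apply: contraNneq C0 => <-.
    have -> : S != setT by apply: contraNneq TC => <-.
    by apply: contraT => H; case: none; exists S; rewrite SC -negb_or.
  apply: le_trans (lubell_subset R sub) _; apply: le_trans (lubellU_le _ _ _) _.
  rewrite lubell_powerset0 lubell_supersetsT.
  have seventh (a b : nat) : (7 * a <= b.+1)%N -> a%:R / b.+1%:R <= 1 / 7 :> R.
    move=> ab; rewrite ler_pdivrMr ?ltr0n // mulrC mulrA mulr1 ler_pdivlMr ?ltr0n //.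
    by rewrite -natrM ler_nat mulnC.
  have -> : 2 / 7 = 1 / 7 + 1 / 7 :> R by rewrite -mulrDl.
  have arith a : (8 * a < n)%N -> (7 * a <= (n - a).+1)%N by clear; lia.
  apply: lerD; apply: seventh; first exact: arith.
  by have := arith _ Zn; rewrite card_setC_ord subKn // card_ord_le.
have [?|[S [SA YS SZ]]] := middle A (subsetUl _ _) TA A0; first by left.
have [?|[T [TB' YT TZ]]] := middle B (subsetUr _ _) TB B0; first by right.
(* Members of both families strictly between [Y] and [Z] yield a cut [W] with [S' \subset W] and
   [W \subset T']: too large for a small cut, too small for a large one. *)
have absurd (C D : {set {set 'I_n}}) S' T' : C :|: D = A :|: B ->
    (forall S T, S \in C -> T \in D -> cmp S T) -> S' \in C -> T' \in D ->
    Y \proper S' -> T' \proper Z -> S' \subset T' -> False.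
  move=> CDE CD SC TD YS' TZ' ST'; have := cut_below CD TD.
  set W := \bigcup_(_ in _ | _) _; rewrite CDE => cutW.
  have SW : S' \subset W by apply: bigcup_sup; rewrite SC.
  have WT : W \subset T' by apply/bigcupsP => X /andP[].
  have [Wn|Wn] := nocut _ cutW.
    have := maxY W; rewrite /lowcut cutW Wn => /(_ isT) /=.
    by rewrite leqNgt (leq_trans (proper_card YS') (subset_leq_card SW)).
  have := minZ W; rewrite /upcut cutW Wn => /(_ isT).
  by rewrite leqNgt (leq_ltn_trans (subset_leq_card WT) (proper_card TZ')).
exfalso; have /orP[ST|TS] := AB _ _ SA TB'; first exact: (absurd A B S T).
apply: (absurd B A T S) => //; first by rewrite setUC.
by move=> *; rewrite cmpC AB.
Qed.

Lemma near_cross_lubell (R : realType) n (A B : {set {set 'I_n}}) :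
  [disjoint A & B] -> near_cross A B ->
  setT \notin A -> set0 \notin A -> setT \notin B -> set0 \notin B -> (0 < n)%N ->
  [\/ lubell R A <= 2 / 7 + 128 / n%:R, lubell R B <= 2 / 7 + 128 / n%:R |
   exists x : R, [/\ 0 < x, lubell R A <= x + 64 / n%:R & lubell R B <= x^-1 + 64 / n%:R]].
Proof.
move=> dAB nc TA A0 TB B0 n0.
have q0 k : 0 <= k%:R / n%:R :> R by rewrite divr_ge0 ?ler0n.
have [AB|[[u [uA uB]]|[u [uB uA]]]] := near_cross_cmp nc.
- have [[Y [cutY nY nYC]]|nocut] := pselect (exists Y,
      [/\ is_cut (A :|: B) Y, n <= 8 * #|Y| & n <= 8 * #|~: Y|]%N).
    have le27 : 128 / n%:R <= 2 / 7 + 128 / n%:R :> R by rewrite lerDr divr_ge0.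
    have [H|H|H] := central_cut_lubell R dAB AB TA A0 TB B0 cutY nY nYC n0.
    + by constructor 1; apply: le_trans le27.
    + by constructor 2; apply: le_trans le27.
    + by constructor 3.
  have le27 : 2 / 7 <= 2 / 7 + 128 / n%:R :> R by rewrite lerDl.
  have [||H] := @no_central_cut_lubell R n A B AB TA A0 TB B0 n0.
  + move=> Y cutY; case: (ltnP (8 * #|Y|) n) => [|nY]; first by left.
    case: (ltnP (8 * #|~: Y|) n) => [|nYC]; first by right.
    by case: nocut; exists Y.
  + by move=> H; constructor 1; apply: le_trans le27.
  + by constructor 2; apply: le_trans le27.
- have [x [x0 Ax Bx]] := near_cross_atom_lubell R dAB nc uA uB TA A0 TB B0.
  constructor 3; exists x; split=> //.
    by apply: le_trans Ax _; rewrite lerDl.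
  by apply: le_trans Bx _; rewrite lerDl.
- rewrite disjoint_sym in dAB.
  have [x [x0 Bx Ax]] := near_cross_atom_lubell R dAB (near_crossC nc) uB uA TB B0 TA A0.
  constructor 3; exists x^-1; rewrite invr_gt0 invrK; split=> //.
    by apply: le_trans Ax _; rewrite lerDl.
  by apply: le_trans Bx _; rewrite lerDl.
Qed.

(** * The limit *)

Lemma sqrt2_bounds (R : realType) :
  [/\ Num.sqrt 2 ^+ 2 = 2 :> R, (141 / 100 : R) <= Num.sqrt 2 & Num.sqrt 2 <= (142 / 100 : R)].
Proof.
have r0 := sqrtr_ge0 (2 : R); have r2 : Num.sqrt 2 ^+ 2 = 2 :> R by rewrite sqr_sqrtr.
by split=> //; move: r0 r2; move: (Num.sqrt 2) => r; nra.
Qed.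

Lemma lubell_nontrivial (R : realType) n (A : {set {set 'I_n}}) :
  lubell R A <= (set0 \in A)%:R + (setT \in A)%:R + lubell R (A :\ set0 :\ setT).
Proof.
have remove (C : {set {set 'I_n}}) (S : {set 'I_n}) : 'C(n, #|S|) = 1%N ->
    lubell R C <= (S \in C)%:R + lubell R (C :\ S).
  move=> CS; have [SC|SC] := boolP (S \in C).
    by rewrite (lubellD1 R SC) CS invr1.
  rewrite add0r lubell_subset //; apply/fintype.subsetP => X XC.
  by rewrite !inE XC andbT; apply: contraNneq SC => <-.
apply: le_trans (remove A set0 _) _; first by rewrite cards0 bin0.
rewrite -addrA lerD2l.
apply: le_trans (remove _ setT _) _; first by rewrite cardsT card_ord binn.
rewrite lerD2r ler_nat !inE; by case: (_ \in A); rewrite ?andbF // andbT leq_b1.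
Qed.

Lemma near_cross_lubell_lt (R : realType) n (A B : {set {set 'I_n}}) (g : R) :
  [disjoint A & B] -> near_cross A B -> (0 < n)%N ->
  1 + Num.sqrt 2 + 64 / n%:R < g -> 128 / n%:R <= 1 / 10 :> R ->
  g <= lubell R A -> g <= lubell R B -> False.
Proof.
move=> dAB nc n0 lg small gA gB.
have [r2 r_ge _] := sqrt2_bounds R.
pose trim (C : {set {set 'I_n}}) := C :\ set0 :\ setT.
have sub (C : {set {set 'I_n}}) : trim C \subset C.
  by apply/fintype.subsetP => S; rewrite !inE => /and3P[].
have nT (C : {set {set 'I_n}}) : setT \notin trim C by rewrite !inE eqxx.
have n0' (C : {set {set 'I_n}}) : set0 \notin trim C by rewrite !inE eqxx andbF.
have dt : [disjoint trim A & trim B].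
  by apply: disjointWl (sub _) _; apply: disjointWr (sub _) _.
have nct : near_cross (trim A) (trim B).
  by move=> S T /(fintype.subsetP (sub _)) SA /(fintype.subsetP (sub _)); apply: nc.
have lA := le_trans gA (lubell_nontrivial R A).
have lB := le_trans gB (lubell_nontrivial R B).
have e0 : (set0 \in A)%:R + (set0 \in B)%:R <= 1 :> R.
  case: (boolP (set0 \in A)) => [/(disjointFr dAB) ->|_]; first by rewrite addr0.
  by rewrite add0r lern1 leq_b1.
have e1 : (setT \in A)%:R + (setT \in B)%:R <= 1 :> R.
  case: (boolP (setT \in A)) => [/(disjointFr dAB) ->|_]; first by rewrite addr0.
  by rewrite add0r lern1 leq_b1.
have := near_cross_lubell R dt nct (nT A) (n0' A) (nT B) (n0' B) n0.
rewrite -!/(trim _) in lA lB *.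
have d0 : 0 <= 64 / n%:R :> R by rewrite divr_ge0 ?ler0n.
have b1 (b : bool) : b%:R <= 1 :> R by rewrite lern1 leq_b1.
have two : 2 = 1 + 1 :> R by [].
have s2 : (set0 \in A)%:R + (setT \in A)%:R <= 2 :> R.
  by rewrite two lerD.
have t2 : (set0 \in B)%:R + (setT \in B)%:R <= 2 :> R.
  by rewrite two lerD.
have st : (set0 \in A)%:R + (setT \in A)%:R + ((set0 \in B)%:R + (setT \in B)%:R) <= 2 :> R.
  by rewrite addrACA two lerD.
have s0 : 0 <= (set0 \in A)%:R + (setT \in A)%:R :> R by rewrite addr_ge0 ?ler0n.
move: lA lB s2 t2 st s0; move: ((set0 \in A)%:R + _) ((set0 \in B)%:R + _) => s t.
move: (lubell R (trim A)) (lubell R (trim B)) => a b.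
move: (64 / n%:R) (128 / n%:R) (Num.sqrt 2) lg small r2 r_ge d0 => d d' r.
clear => lg small r2 r_ge d0 lA lB s2 t2 st s0.
(* In the first two cases a mass is at most [2 + 2 / 7 + 1 / 10], which is below [1 + 141 / 100]. In
   the third, [x * x^-1 = 1] bounds the product of the masses left after removing trivial sets and
   error. *)
case=> [la|lb|[x [x0 la lb]]]; try lra.
have hx : g - d - s <= x by lra.
have hy : g - d - 2 + s <= x^-1 by lra.
have : (g - d - s) * (g - d - 2 + s) <= 1.
  by rewrite -[leRHS](divff (lt0r_neq0 x0)); apply: ler_pM => //; lra.
apply/negP; rewrite -ltNge.
(* [(h - s) * (h - 2 + s) = (h - 1) ^ 2 - 1 + s * (2 - s)] for [h = g - d]. *)
have : r ^+ 2 < (g - d - 1) ^+ 2 by rewrite -subr_gt0 subr_sqr mulr_gt0 //; lra.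
have : 0 <= s * (2 - s) by rewrite mulr_ge0 //; lra.
by rewrite r2; clear; lra.
Qed.

(** Upward closure turns failure at [l - e] into a lower bound of [E n], and [l + e] shows it
    nonempty, so [inf] is a genuine infimum for large [n]. *)
Lemma inf_cvg (R : realType) (E : nat -> set R) (l : R) :
  (forall n g g', g <= g' -> E n g -> E n g') ->
  (forall e, 0 < e -> exists N, forall n, (N <= n)%N -> E n (l + e) /\ ~ E n (l - e)) ->
  (inf (E n) @[n --> \oo] --> l)%classic.
Proof.
move=> up H; apply/cvgrPdist_le => e e0.
have [N HN] := H e e0; exists N => // n /= Nn; have [Ein Eout] := HN n Nn.
have lb : lbound (E n) (l - e).
  move=> g Eg; rewrite leNgt; apply/negP => /ltW le_g; apply: Eout.
  exact: up Eg.
rewrite distrC ler_norml; apply/andP; split.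
  rewrite lerBrDl; apply: lb_le_inf => //; by exists (l + e).
by rewrite lerBlDl; apply: ge_inf => //; exists (l - e).
Qed.

Lemma Gpcol_upper (R : realType) n (g : R) (phi : pcoloring n 2) : (0 < n)%N ->
  1 + Num.sqrt 2 + 64 / n%:R < g -> 128 / n%:R <= 1 / 10 :> R ->
  (forall i, g <= lubell R (color_class phi i)) -> strong_rainbow phi.
Proof.
move=> n0 lg small big; apply: contraT => nr; exfalso.
apply: (near_cross_lubell_lt _ _ n0 lg small (big ord0) (big ord_max)).
  rewrite disjoint_subset; apply/fintype.subsetP => S; rewrite !inE => /eqP ->.
  by [].
by move=> S T SA TB; rewrite (no_rainbow_comparable_classes nr).
Qed.

Lemma Gcol_upper (R : realType) n (g : R) (phi : coloring n 3) : (3 < n)%N ->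
  1 + Num.sqrt 2 + 64 / n%:R < g -> 128 / n%:R <= 1 / 10 :> R ->
  (forall i, g <= lubell R (color_class (partial_of phi) i)) ->
  strong_rainbow (partial_of phi).
Proof.
move=> n3 lg small big; apply: contraT => nr; exfalso.
have n0 : (0 < n)%N by apply: leq_trans n3.
have [[i [j [ij nc]]]|[l [T [T1 sub]]]] := @three_coloring_structure n 2 phi isT n3 nr.
  apply: (near_cross_lubell_lt _ nc n0 lg small (big i) (big j)).
  rewrite disjoint_subset; apply/fintype.subsetP => S; rewrite !inE => /eqP ->.
  by apply: contra ij => /eqP[->].
have CT : 'C(n, #|T|) = n.
  case/orP: T1 => /eqP E; first by rewrite E bin1.
  by rewrite -bin_sub ?card_ord_le // -card_setC_ord E bin1.
have CT' : 'C(n, #|~: T|) = n by rewrite card_setC_ord bin_sub ?card_ord_le.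
(* The exceptional class has mass at most [2 + 2 / n], which is below [g]. *)
have lT : lubell R [set set0; setT; T; ~: T] <= 1 + 1 + n%:R^-1 + n%:R^-1.
  apply: le_trans (lubellU_le _ _ _) (lerD _ _); last by rewrite lubell1 CT'.
  apply: le_trans (lubellU_le _ _ _) (lerD _ _); last by rewrite lubell1 CT.
  apply: le_trans (lubellU_le _ _ _) (lerD _ _); rewrite lubell1 ?cards0 ?bin0 ?invr1 //.
  by rewrite cardsT card_ord binn invr1.
have := le_trans (big l) (le_trans (lubell_subset R sub) lT); apply/negP; rewrite -ltNge.
have [_ r_ge _] := sqrt2_bounds R.
have ni : 0 <= n%:R^-1 :> R by rewrite invr_ge0 ler0n.
move: (n%:R^-1) (Num.sqrt 2) ni lg small r_ge => y r; clear; lra.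
Qed.

(** * Lubell masses of the extremal pair *)

Lemma lubell_lower_family (R : realType) n (Y : {set 'I_n}) : Y != setT ->
  lubell R (lower_family Y) = 1 + n.+1%:R / (n - #|Y|).+1%:R.
Proof.
move=> YT; rewrite /lower_family /lubell big_setU1 /=; last first.
  by rewrite inE subTset.
rewrite cardsT card_ord binn invr1; congr (_ + _).
by rewrite -/(lubell R _) lubell_powerset card_setC_ord.
Qed.

(** From all supersets of [Y] the set [setT] takes away mass 1 and [Y] itself a single inverse
    binomial, bounded by viewing [[set Y]] as the interval from [Y] to [Y]. *)
Lemma lubell_upper_family (R : realType) n (Y : {set 'I_n}) : Y != setT ->
  (n <= 8 * #|Y|)%N -> (0 < n)%N ->
  n.+1%:R / #|Y|.+1%:R - 1 - 64 / n%:R <= lubell R (upper_family Y) <= n.+1%:R / #|Y|.+1%:R.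
Proof.
move=> YT nY n0; rewrite -lubell_supersets.
have upE : upper_family Y = [set Z : {set 'I_n} | Y \subset Z] :\ setT :\ Y.
  by apply/setP => Z; rewrite !inE properEneq [Y == Z]eq_sym andbCA.
apply/andP; split; last first.
  by rewrite lubell_subset // upE; apply: fintype.subset_trans (subsetDl _ _) (subsetDl _ _).
rewrite (@lubellD1 _ _ _ setT) ?inE ?subsetT // cardsT card_ord binn invr1.
rewrite [1 + _]addrC addrK (@lubellD1 _ _ _ Y) ?inE ?YT ?fintype.subxx // -upE.
rewrite addrAC gerDr subr_le0; have := @lubell_subcube_upper_small R n Y Y YT nY n0.
have -> : subcube Y Y = [set Y].
  by apply/setP => S; rewrite !inE -eqEsubset eq_sym.
by rewrite lubell1.
Qed.

Lemma balanced_families (R : realType) n (e : R) : 0 < e -> 128 <= e * n%:R -> (100 <= n)%N ->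
  exists Y : {set 'I_n},
    [/\ 1 + Num.sqrt 2 - e <= lubell R (lower_family Y),
        1 + Num.sqrt 2 - e <= lubell R (upper_family Y) &
        1 + Num.sqrt 2 - e <= lubell R (~: (lower_family Y :|: upper_family Y))].
Proof.
move=> e0 en n100; have [r2 r_ge r_le] := sqrt2_bounds R.
have n0 : (0 < n)%N by apply: leq_trans n100.
have N0 : 0 < n%:R :> R by rewrite ltr0n.
have N100 : 100 <= n%:R :> R by rewrite (ler_nat R 100 n).
have e64 : 64 / n%:R <= e / 2 by rewrite ler_pdivrMr //; lra.
move: (Num.sqrt 2) r2 r_ge r_le => r r2 r_ge r_le.
(* For [y / n = 1 - r / 2] the ratio [y / (n - y)] is [r - 1], the solution of [x + 2 = 1 / x]. *)
pose a := (1 - r / 2) * n%:R.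
have a_ge : 29 / 100 * n%:R <= a by rewrite ler_wpM2r ?ler0n //; lra.
have a_le : a <= 295 / 1000 * n%:R by rewrite ler_wpM2r ?ler0n //; lra.
have a0 : 0 <= a by lra.
pose y := Num.truncn a.
have /andP[ya] : y%:R <= a < y.+1%:R by apply: truncn_itv.
rewrite -natr1 => ay.
have yn : (y < n)%N by rewrite -(ltr_nat R); lra.
have ny : (n <= 8 * y)%N by rewrite -(ler_nat R) natrM; lra.
have [Y [_ _ Yy]] : exists U : {set 'I_n}, [/\ set0 \subset U, U \subset setT & #|U| = y].
  by apply: exists_set_between; rewrite ?sub0set // cards0 cardsT card_ord leq0n /= ltnW.
have YT : Y != setT by apply: contraTneq yn => E; rewrite -Yy E cardsT card_ord ltnn.
have lE := lubell_lower_family R YT.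
have /andP[u_ge u_le] := lubell_upper_family R YT (etrans (congr1 (leq n \o muln 8) Yy) ny) n0.
rewrite Yy in lE u_ge u_le.
have my : (n - y).+1%:R = n%:R - y%:R + 1 :> R by rewrite -natr1 natrB // ltnW.
have sy : y.+1%:R = y%:R + 1 :> R by rewrite natr1.
have sn : n.+1%:R = n%:R + 1 :> R by rewrite natr1.
rewrite my sn in lE; rewrite sy sn in u_ge u_le.
have y0 : 0 <= y%:R :> R by rewrite ler0n.
exists Y; split.
- rewrite lE; suff : r - e <= (n%:R + 1) / (n%:R - y%:R + 1) by lra.
  rewrite ler_pdivlMr; last lra.
  have [re|re] := leP (r - e) 0.
    by apply: le_trans (_ : 0 <= _); [rewrite mulr_le0_ge0 //; lra|lra].
  have le1 : n%:R - y%:R + 1 <= r / 2 * n%:R + 2 by rewrite /a in ay; lra.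
  apply: le_trans (ler_wpM2l (ltW re) le1) _.
  (* After expansion and [r ^+ 2 = 2] the leading term is exactly [n]; the term [- e * n * r / 2]
     outweighs the positive constant [2 * r]. The upper family below is treated likewise. *)
  have : 128 * (141 / 100) <= e * n%:R * r by apply: ler_pM => //; lra.
  have -> : (r - e) * (r / 2 * n%:R + 2) =
      r ^+ 2 * n%:R / 2 + 2 * r - e * n%:R * r / 2 - 2 * e by field.
  rewrite r2; lra.
- apply: le_trans u_ge; suff : 2 + r - e / 2 <= (n%:R + 1) / (y%:R + 1) by lra.
  rewrite ler_pdivlMr; last lra.
  have [re|re] := leP (2 + r - e / 2) 0.
    by apply: le_trans (_ : 0 <= _); [rewrite mulr_le0_ge0 //; lra|lra].
  have le1 : y%:R + 1 <= (1 - r / 2) * n%:R + 1 by rewrite /a in ya; lra.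
  apply: le_trans (ler_wpM2l (ltW re) le1) _.
  have : 128 * (29 / 100) <= e * n%:R * (1 - r / 2) by apply: ler_pM => //; lra.
  have -> : (2 + r - e / 2) * ((1 - r / 2) * n%:R + 1) =
      2 * n%:R - r ^+ 2 * n%:R / 2 + 2 + r - e * n%:R * (1 - r / 2) / 2 - e / 2 by field.
  rewrite r2; lra.
(* The third family is everything else: the whole lattice has mass [n + 1], of which the pair takes
   at most [3 + 4]. *)
have tot : n.+1%:R <= lubell R (lower_family Y) + lubell R (upper_family Y)
    + lubell R (~: (lower_family Y :|: upper_family Y)).
  have := lubell_powerset R [set: 'I_n]; rewrite setCT cards0 divr1 => <-.
  rewrite powersetT -[X in lubell _ X](setUCr (lower_family Y :|: upper_family Y)).
  by apply: le_trans (lubellU_le _ _ _) _; rewrite lerD2r lubellU_le.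
have l3 : lubell R (lower_family Y) <= 3.
  rewrite lE; suff : (n%:R + 1) / (n%:R - y%:R + 1) <= 2 :> R by lra.
  by rewrite ler_pdivrMr; lra.
have u4 : lubell R (upper_family Y) <= 4.
  by apply: le_trans u_le _; rewrite ler_pdivrMr; lra.
by rewrite sn in tot; lra.
Qed.

(** The threshold 1280 gives [128 / n <= 1 / 10]; the other two bounds feed [balanced_families] and
    the upper estimates respectively. *)
Lemma eventually_large (R : realType) (e : R) : 0 < e ->
  exists N, forall n, (N <= n)%N ->
    [/\ 1280 <= n%:R :> R, 128 <= e * n%:R & 64 / n%:R < e].
Proof.
move=> e0; exists (maxn 1280 (Num.truncn (128 / e)).+1) => n.
rewrite geq_max => /andP[n1 n2].
have N1 : 1280 <= n%:R :> R by rewrite (ler_nat R 1280 n).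
have N2 : 128 < e * n%:R.
  rewrite mulrC -ltr_pdivrMr //; apply: lt_le_trans (_ : (Num.truncn (128 / e)).+1%:R <= _).
    by apply: truncnS_gt.
  by rewrite ler_nat.
by split=> //; [exact: ltW|rewrite ltr_pdivrMr; lra].
Qed.

Local Open Scope classical_set_scope.
Local Open Scope ring_scope.

Theorem theorem4p9 (R : realType) :
  (forall n : nat, (18 <= n)%N -> Fcol n 3 = Fpcol n 2) /\
  ((Gcol R n 3 @[n --> \oo] --> (1 + Num.sqrt 2 : R)) /\
   (Gpcol R n 2 @[n --> \oo] --> (1 + Num.sqrt 2 : R))).
Proof.
split; first exact: Fcol3_eq_Fpcol2.
have small n : 1280 <= n%:R :> R -> 128 / n%:R <= 1 / 10 :> R.
  by move=> n1; rewrite ler_pdivrMr; lra.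
have nat_ge n m : 1280 <= n%:R :> R -> (m <= 1280)%N -> (m <= n)%N.
  by move=> n1 /leq_trans; apply; rewrite -(ler_nat R).
split; apply: inf_cvg.
- by move=> n g g' gg' Eg phi big; apply: Eg => i; apply: le_trans (big i).
- move=> e /[dup] e0 /eventually_large[N HN]; exists N => n /HN[n1 en n64]; split.
    move=> phi; apply: Gcol_upper; [exact: nat_ge|lra|exact: small].
  (* The value [1 + sqrt 2 - e] does not qualify: the extremal pair and the remaining sets as third
     class reach it without a rainbow antichain. *)
  have [Y [lY uY mY]] := balanced_families e0 en (nat_ge n 100 n1 isT).
  have d := lower_upper_disjoint Y.
  move=> H; have [_ /negP[]] := cross_comparable_no_rainbow d (@lower_upper_cmp _ Y).
  apply: H => i; rewrite coloring_of_class //.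
  by case: ifP => _ //; case: ifP.
- by move=> n g g' gg' Eg phi big; apply: Eg => i; apply: le_trans (big i).
move=> e /[dup] e0 /eventually_large[N HN]; exists N => n /HN[n1 en n64]; split.
  move=> phi; apply: Gpcol_upper; [exact: nat_ge|lra|exact: small].
have [Y [lY uY _]] := balanced_families e0 en (nat_ge n 100 n1 isT).
have d := lower_upper_disjoint Y.
move=> H; have [/negP nr _] := cross_comparable_no_rainbow d (@lower_upper_cmp _ Y).
by apply: nr; apply: H => i; rewrite pcoloring_of_class //; case: ifP.
Qed.
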